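(* Let $G\subset\mathbb{RP}^2$ be a connected, non-local embedded graph with Poincaré dual $G^*\subset\mathbb{RP}^2$. Then the generalized Krushkal polynomial $K_G(x,y,A,B)$ is equivalent to the pair $\{\psi_G(x,y),\psi_{G^*}(x,y)\}$ of myopic Tutte polynomials. Namely, $$K_G(x,y,0,1)=\psi_G(x,y)$$ and $$K_G(x,y,A,B)=\sqrt{B}\,\psi_G(x,y)+\sqrt{A}\,\psi_{G^*}(y,x).$$
   Context: A graph embedded in $\mathbb{RP}^2$ is local if it is contained in a disk in $\mathbb{RP}^2$. Myopic Tutte polynomial: $\psi_G\in\mathbb{Z}[x,y]$ is defined recursively by: $\psi_G=\psi_{G-e}+\psi_{G/e}$ if $e$ is neither a bridge nor a loop; $\psi_G=x\,\psi_{G/e}$ if $e$ is a bridge; $\psi_G=y\,\psi_{G-e}$ if $e$ is a loop with $[e]=0\in H_1(\mathbb{RP}^2)$; $\psi_G=\psi_{G-e}$ if $e$ is a loop with $[e]\ne0\in H_1(\mathbb{RP}^2)$; $\psi_G=1$ if $G$ has no edges. Generalized Krushkal polynomial of a graph $G$ embedded in a closed surface $\Sigma$: $$K_G(x,y,A,B)=\sum_{H\subseteq G}(x-1)^{b_0(H)-b_0(G)}(y-1)^{\dim\ker(i_*^H)}A^{s(H)/2}B^{s^\perp(H)/2},$$ the sum over all spanning subgraphs $H$ (same vertex set as $G$), where $i_*^H:H_1(H;\mathbb{Z}/2)\to H_1(\Sigma;\mathbb{Z}/2)$ is induced by inclusion, $s(H)=2b_0(H)-\chi(\mathcal{S}(H))$,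 $s^\perp(H)=2b_0(\Sigma-H)-\chi(\mathcal{S}^\perp(H))$, and $\mathcal{S}(H)$, $\mathcal{S}^\perp(H)$ are the closed surfaces obtained by gluing a disk to every boundary component of $\nu(H)$, respectively of $\Sigma-\nu(H)$, for $\nu(H)$ a small regular neighborhood of $H$. (Convention $0^0=1$ when setting $A=0$.) *)

(* Defs.v *)
From HB Require Import structures.
From mathcomp Require Import all_boot all_order all_algebra.
From mathcomp Require Import mpoly.

Set Implicit Arguments.
Unset Strict Implicit.
Unset Printing Implicit Defensive.

Import GRing.Theory Num.Theory.
Local Open Scope ring_scope.

(* A closed surface is presented by a cellular decomposition, encoded as a    *)
(* generalized (possibly non-orientable) combinatorial map. A flag            *)
(* (e, i, s) is a triangle of the barycentric subdivision: an edge e, one of  *)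
(* its two ends i and one of its two sides s. Along an edge, triangles are    *)
(* glued by flip_end and flip_side; across a corner (the angle between two    *)
(* consecutive edges of a face) they are glued by the map [corner] below.     *)
(* The vertices, edges and faces are the orbits of <corner, flip_side>,       *)
(* <flip_end, flip_side> and <corner, flip_end>, respectively.                *)
Definition flag (E : finType) : finType := (E * bool * bool)%type.

Section Flags.
Variable E : finType.
Implicit Types f : flag E.

Definition edge_of f : E := f.1.1.
Definition flip_end f : flag E := (f.1.1, ~~ f.1.2, f.2).
Definition flip_side f : flag E := (f.1.1, f.1.2, ~~ f.2).
Definition swap_end_side f : flag E := (f.1.1, f.2, f.1.2).

End Flags.

(* A graph G embedded in a closed surface, given together with a cellular     *)
(* decomposition of the surface of which G is a spanning subgraph: [skel] is  *)
(* the edge set of the decomposition, [edges] that of G, and the vertices of  *)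
(* G are all the vertices of the decomposition. The embedding of G need not   *)
(* be cellular, and G need not be connected: any nonempty graph embedded in a *)
(* connected surface becomes the 1-skeleton of a cellular decomposition by    *)
(* adding edges. E is only a finite set of names; the labels outside [skel],  *)
(* and the values of [corner] there, are irrelevant.                          *)
Record embgraph (E : finType) := EmbGraph {
  skel : {set E};
  corner : flag E -> flag E;
  edges : {set E}
}.

Section EmbeddedGraphs.
Variable E : finType.
Implicit Types (G : embgraph E) (e : E) (H P Q : {set E}) (f g : flag E).

Definition flags G : {set flag E} := [set f | edge_of f \in skel G].

Definition well_formed G : Prop :=
  [/\ edges G \subset skel G,
      {in flags G, forall f, corner G f \in flags G},
      {in flags G, forall f, corner G (corner G f) = f}
    & {in flags G, forall f, corner G f != f}].

(* The union of the flags, glued across all corners, along flip_end for the   *)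
(* edges in P and along flip_side for the edges in Q.                         *)
Definition adj G P Q : rel (flag E) := fun f g =>
  [&& f \in flags G, g \in flags G &
   [|| g == corner G f,
       (edge_of f \in P) && (g == flip_end f)
     | (edge_of f \in Q) && (g == flip_side f)]].

Definition orbits G P Q : nat := n_comp (adj G P Q) (flags G).

Definition vertex_adj G := adj G set0 (skel G).
Definition face_adj G := adj G (skel G) set0.
Definition nb_vertices G : nat := orbits G set0 (skel G).
Definition nb_faces G : nat := orbits G (skel G) set0.

(* Number of components of the spanning subgraph with edge set H.             *)
Definition b0 G H : nat := orbits G H (skel G).
(* Number of components of the complement of that subgraph: faces are joined  *)
(* across the edges that are not in H.                                        *)
Definition b0_compl G H : nat := orbits G (skel G) (skel G :\: H).
(* Number of boundary circles of a regular neighbourhood of that subgraph:    *)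
(* such a circle follows the sides of the edges in H and crosses the ends of  *)
(* the edges not in H. The orbits also count the boundaries of the            *)
(* neighbourhoods of isolated vertices.                                       *)
Definition nb_boundary G H : nat := orbits G H (skel G :\: H).

Definition euler_surface G : int :=
  (nb_vertices G)%:Z - #|skel G|%:Z + (nb_faces G)%:Z.

(* By the classification of surfaces, RP^2 is the only connected closed       *)
(* surface of Euler characteristic 1.                                         *)
Definition in_RP2 G : Prop :=
  [/\ well_formed G, orbits G (skel G) (skel G) = 1%N & euler_surface G = 1].

Definition connected_graph G : Prop := b0 G (edges G) = 1%N.

(* G is contained in a disk: some subcomplex containing G, with edge set H    *)
(* and with the faces that make up W, has a disk as regular neighbourhood,    *)
(* i.e. it omits a face (so that the neighbourhood has a nonempty boundary),  *)
(* it is connected and its Euler characteristic is 1. Any disk containing G   *)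
(* may be brought to this form if G is connected, and also for every G in     *)
(* RP^2.                                                                      *)
Definition local_graph G : Prop :=
  exists (H : {set E}) (W : {set flag E}),
    [/\ (edges G \subset H) && (H \subset skel G),
        [/\ W \proper flags G, closed (face_adj G) W
          & {in W, forall f, edge_of f \in H}],
        b0 G H = 1%N
      & (nb_vertices G)%:Z - #|H|%:Z + (n_comp (face_adj G) W)%:Z = 1].

(* The cellular chain complex of the surface with coefficients in Z/2; chains *)
(* are row vectors. A vertex or a face is represented by each of its flags,   *)
(* so that columns of bd1 and rows of bd2 are repeated.                       *)
Definition bd1 G : 'M['F_2]_(#|E|, #|flag E|) :=
  \matrix_(j, k)
    (\sum_(i : bool)
       connect (vertex_adj G) (enum_val k) (enum_val j, i, false))%:R.

Definition bd2 G : 'M['F_2]_(#|flag E|, #|E|) :=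
  \matrix_(k, j) (if enum_val k \in flags G then
    (\sum_(s : bool)
       connect (face_adj G) (enum_val k) (enum_val j, false, s))%:R else 0).

Definition chains1 H : 'M['F_2]_#|E| :=
  \matrix_(j, k) ((j == k) && (enum_val j \in H))%:R.

(* H_1(H; Z/2): the 1-cycles of the subgraph with edge set H.                 *)
Definition H1_graph G H : 'M['F_2]_#|E| := (chains1 H :&: kermx (bd1 G))%MS.

(* dim ker (H_1(H; Z/2) -> H_1(Sigma; Z/2)), the target being the quotient of *)
(* the 1-cycles of the surface by the row space of bd2.                       *)
Definition dim_ker_incl G H : nat := \rank (H1_graph G H :&: bd2 G)%MS.

Definition is_loop G e : bool :=
  connect (vertex_adj G) (e, false, false) (e, true, false).

Definition is_bridge G e : bool :=
  (b0 G (edges G) < b0 G (edges G :\ e))%N.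

(* The class of the loop e vanishes in H_1(Sigma; Z/2); for Sigma = RP^2 this *)
(* is also its vanishing in H_1(Sigma; Z) = Z/2.                              *)
Definition null_homologous G e : bool :=
  (delta_mx (0 : 'I_1) (enum_rank e) <= bd2 G)%MS.

(* Deletion leaves the cellular decomposition unchanged.                      *)
Definition delete G e : embgraph E :=
  EmbGraph (skel G) (corner G) (edges G :\ e).

(* Contraction, in the surface, of a set C of edges that forms a forest: the  *)
(* walks around the faces skip the edges in C. As flags are the only          *)
(* carriers of vertices, contracting the only edge of a decomposition of the  *)
(* sphere is not represented; this does not occur in RP^2.                    *)
Definition contract_corner G (C : {set E}) f : flag E :=
  head f [seq g <- traject (fun g => corner G (flip_end g)) (corner G f)
                           #|flag E| | edge_of g \notin C].

Definition contract_set G (C : {set E}) : embgraph E :=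
  EmbGraph (skel G :\: C) (contract_corner G C) (edges G :\: C).

Definition contract G e : embgraph E := contract_set G [set e].

(* The dual decomposition, in which each edge is replaced by the edge         *)
(* crossing it.                                                               *)
Definition dual_decomposition G : embgraph E :=
  EmbGraph (skel G)
    (fun f => swap_end_side (corner G (swap_end_side f))) (edges G).

(* The Poincare dual of a cellularly embedded G. Its vertices are the faces   *)
(* of G: the dual edges crossing no edge of G form a spanning tree of faces   *)
(* of the decomposition inside each face of G, and are contracted.            *)
Definition poincare_dual G : embgraph E :=
  contract_set (dual_decomposition G) (skel G :\: edges G).

(* Euler characteristics of the surfaces obtained by capping off a regular    *)
(* neighbourhood of the subgraph H, respectively the complement of that       *)
(* neighbourhood. The latter is homotopy equivalent to the graph whose        *)
(* vertices are the faces of the decomposition and whose edges are dual to    *)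
(* the edges that are not in H.                                               *)
Definition euler_capped G H : int :=
  (nb_vertices G)%:Z - #|H|%:Z + (nb_boundary G H)%:Z.
Definition euler_capped_compl G H : int :=
  (nb_faces G)%:Z - #|skel G :\: H|%:Z + (nb_boundary G H)%:Z.

(* Both are nonnegative, being sums over the components S of the capped       *)
(* surface of 2 - chi(S); the absolute value is only a cast to nat.           *)
Definition s_exp G H : nat :=
  `| (2 * b0 G H)%N%:Z - euler_capped G H |%N.
Definition s_perp_exp G H : nat :=
  `| (2 * b0_compl G H)%N%:Z - euler_capped_compl G H |%N.

End EmbeddedGraphs.

Definition var (n i : nat) (lt_i_n : (i < n)%N) : {mpoly int[n]} :=
  'X_(Ordinal lt_i_n).

(* The variables x, y of Z[x, y].                                             *)
Definition x2 : {mpoly int[2]} := @var 2 0 isT.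
Definition y2 : {mpoly int[2]} := @var 2 1 isT.

(* The variables x, y, A^(1/2), B^(1/2) of Z[x, y, A^(1/2), B^(1/2)].         *)
Definition x4 : {mpoly int[4]} := @var 4 0 isT.
Definition y4 : {mpoly int[4]} := @var 4 1 isT.
Definition sqrtA : {mpoly int[4]} := @var 4 2 isT.
Definition sqrtB : {mpoly int[4]} := @var 4 3 isT.

Definition krushkal (E : finType) (G : embgraph E) : {mpoly int[4]} :=
  \sum_(H : {set E} | H \subset edges G)
    (x4 - 1) ^+ (b0 G H - b0 G (edges G))%N * (y4 - 1) ^+ dim_ker_incl G H *
    sqrtA ^+ s_exp G H * sqrtB ^+ s_perp_exp G H.

(* [myopic_rec G p]: p can be computed from G by the recursion, for some      *)
(* order of the edges.                                                        *)
Inductive myopic_rec (E : finType) : embgraph E -> {mpoly int[2]} -> Prop :=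
| MyopicEmpty G : edges G = set0 -> myopic_rec G 1
| MyopicOrdinary G e p q :
    e \in edges G -> ~~ is_bridge G e -> ~~ is_loop G e ->
    myopic_rec (delete G e) p -> myopic_rec (contract G e) q ->
    myopic_rec G (p + q)
| MyopicBridge G e p :
    e \in edges G -> is_bridge G e ->
    myopic_rec (contract G e) p -> myopic_rec G (x2 * p)
| MyopicNullLoop G e p :
    e \in edges G -> is_loop G e -> null_homologous G e ->
    myopic_rec (delete G e) p -> myopic_rec G (y2 * p)
| MyopicEssentialLoop G e p :
    e \in edges G -> is_loop G e -> ~~ null_homologous G e ->
    myopic_rec (delete G e) p -> myopic_rec G p.

(* psi is the myopic Tutte polynomial of G: the recursion terminates and, for *)
(* every order of the edges, computes psi.                                    *)
Definition is_myopic_tutte (E : finType) (G : embgraph E)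
    (psi : {mpoly int[2]}) : Prop :=
  forall p, myopic_rec G p <-> p = psi.

(* Main.v *)
(* For a subgraph H, the components of H, of its complement and of the        *)
(* boundary of its neighbourhood are orbits of flags under corner, flip_end   *)
(* on some edges P and flip_side on some edges Q. Their number is the         *)
(* dimension of the space of invariant functions with values in F_2, so that  *)
(* submodularity of orbit counts is submodularity of dimension. In RP^2 this, *)
(* with the inequality V - |H| + bd(H) <= 2 b0(H) for H and for its dual,     *)
(* gives bd(H) + 1 = b0(H) + b0(complement of H), whence s(H) + s^perp(H) = 1,*)
(* and s(H) = 1 exactly when H is essential. Moreover dim ker i_* is          *)
(* b0(complement of H) - 1, as the kernel consists of the boundaries of       *)
(* functions on the components of the complement. Hence K_G is sqrt B times   *)
(* the sum over the inessential H plus sqrt A times the sum over the          *)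
(* essential ones. The first sum satisfies the myopic recursion for every     *)
(* order of the edges; complementation turns the second into the first sum    *)
(* for the Poincare dual. Nonlocality is used to know that G itself is        *)
(* essential, i.e. that the dual edges contracted to form G^* are a forest.   *)

Require Import Defs.
From mathcomp Require Import all_boot all_order all_algebra.
From mathcomp Require Import mpoly.
From mathcomp Require Import zify ring.

Set Implicit Arguments.
Unset Strict Implicit.
Unset Printing Implicit Defensive.

Import GRing.Theory Num.Theory.
Local Open Scope ring_scope.

(** * Vectors over F_2 and orbits of a relation *)

(** The first homology of the projective plane over Z/2 is one-dimensional, so the map [i_*] of a
    subgraph [H] has rank 0 or 1, and [essential] records which. Everything is governed by the three
    numbers [#|H|], [b0 G H] and [b0_compl G H]: [nb_boundary_RP2] eliminates the number of boundary
    circles, [dim_ker_inclE] computes the kernel of [i_*], and [essentialE] identifies the rank,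
    which is the cycle rank of [H] minus the dimension of the kernel. The exponents of sqrt A and
    sqrt B are therefore 0 or 1 with sum 1, and [krushkal_split] separates the inessential subgraphs
    from the essential ones.

    The inessential half is [myopic_sum]. Its recursion compares the terms of [H] and [e |: H]: of
    the two exponents, a bridge changes only that of x - 1 and a null-homologous loop only that of y
    - 1; an essential loop makes [e |: H] essential, so that its term disappears; for any other edge
    the two families are the sums of the deletion and of the contraction. This gives
    [myopic_rec_unique] and [myopic_rec_sum].

    The essential half is carried to the dual by complementation, which exchanges components of the
    subgraph with components of its complement and negates [essential] ([essential_dual],
    [comp_myopic_sum_dual]). The dual is obtained by contraction of a forest ([complement_forest]),
    for which [G] must be essential; this holds because a connected inessential graph lies in a disk
    ([inessential_local]). *)

Section CoordinateVectors.
Variable T : finType.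
Implicit Types (v : 'rV['F_2]_#|T|) (w : T -> 'F_2).

Definition coef v : T -> 'F_2 := fun x => v 0 (enum_rank x).
Definition vec w : 'rV['F_2]_#|T| := \row_k w (enum_val k).

Lemma coef_vec w x : coef (vec w) x = w x.
Proof. by rewrite /coef mxE enum_rankK. Qed.

Lemma coefP v1 v2 : coef v1 =1 coef v2 -> v1 = v2.
Proof.
by move=> eqv; apply/rowP => k; rewrite -(enum_valK k); apply: eqv.
Qed.

Lemma coefM n (u : 'rV['F_2]_n) (M : 'M_(n, #|T|)) x :
  coef (u *m M) x = \sum_k u 0 k * M k (enum_rank x).
Proof. by rewrite /coef mxE. Qed.

End CoordinateVectors.

Lemma F2_addrr (a : 'F_2) : a + a = 0.
Proof. by apply: addrr_pchar2; apply: pchar_Fp. Qed.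

Lemma F2_addr_eq0 (a b : 'F_2) : (a + b == 0) = (a == b).
Proof. by rewrite addr_eq0 oppr_pchar2 ?pchar_Fp. Qed.

Lemma F2_neq (a b : 'F_2) : a != b -> a = b + 1.
Proof.
by case: a b => [[|[|//]] ?] [[|[|//]] ?] //= _; apply/val_inj.
Qed.

Lemma F2_cases (a : 'F_2) : a = 0 \/ a = 1.
Proof. by case: a => [[|[|//]] ?]; [left|right]; apply/val_inj. Qed.

Lemma natr_bool_F2_inj (a b : bool) : a%:R = b%:R :> 'F_2 -> a = b.
Proof.
by case: a; case: b => // /eqP; rewrite ?oner_eq0 // eq_sym oner_eq0.
Qed.

Section ClosedSetInvolution.
Variables (T : finType) (A : {set T}) (s : T -> T) (w : T -> 'F_2).
Hypothesis sA : {in A, forall x, s x \in A}.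
Hypothesis sK : {in A, forall x, s (s x) = x}.
Hypothesis s_free : {in A, forall x, s x != x}.
Hypothesis sw : {in A, forall x, w (s x) = w x}.

(** The two elements of an orbit of [s] contribute [w x + w x = 0]. With [s] the gluing across
    corners, this is the source of all parity arguments below. *)
Lemma sum_free_involution : \sum_(x in A) w x = 0.
Proof.
rewrite (bigID (fun x => (enum_rank x < enum_rank (s x))%N)) /=.
rewrite [X in _ + X](reindex_onto s s) /=; last by move=> x /andP[/sK].
rewrite (_ : (\sum_(_ | _) w (s _)) =
             \sum_(x in A | (enum_rank x < enum_rank (s x))%N) w x).
  by rewrite F2_addrr.
apply: eq_big => [x|x].
  have [xA|xA] /= := boolP (x \in A); last first.
    apply/negP=> /andP[/andP[sxA _] /eqP ssx].
    by rewrite -ssx sA in xA.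
  rewrite sA // sK // eqxx andbT -leqNgt leq_eqVlt; case: eqP => //= eq_x.
  by have := s_free xA; rewrite -(enum_rank_inj (ord_inj eq_x)) eqxx.
by move=> /andP[/andP[sxA _] /eqP ssx]; rewrite -(sw sxA) ssx.
Qed.

End ClosedSetInvolution.

Section OrbitSpace.
Variables (T : finType) (r : rel T) (A : {set T}).
Hypotheses (r_sym : connect_sym r) (rA : closed r A).

(* The row space consists of the functions supported on A that are constant   *)
(* on the components of r.                                                    *)
Definition orbit_mx : 'M['F_2]_#|T| :=
  \matrix_(k, l)
    ((enum_val k \in A) && connect r (enum_val k) (enum_val l))%:R.

Lemma coef_orbit_mx u x :
  coef (u *m orbit_mx) x = \sum_(y in A | connect r y x) coef u y.
Proof.
rewrite coefM (reindex enum_rank) /=; last first.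
  by apply: onW_bij; apply: enum_rank_bij.
rewrite [RHS]big_mkcond; apply: eq_bigr => y _.
by rewrite mxE !enum_rankK /coef; case: ifP; rewrite ?mulr1 ?mulr0.
Qed.

Lemma orbit_mxP v :
  (v <= orbit_mx)%MS <->
  (forall x y, r x y -> coef v x = coef v y) /\
  (forall x, x \notin A -> coef v x = 0).
Proof.
split=> [/submxP[u ->]|[v_r v0]].
  split=> [x y rxy|x xA]; rewrite !coef_orbit_mx.
    apply: eq_bigl => z; congr (_ && _).
    by rewrite !(r_sym z); apply: same_connect => //; apply: connect1.
  apply: big1 => y /andP[yA /(closed_connect rA)].
  by rewrite yA (negPf xA).
have v_con x y : connect r x y -> coef v x = coef v y.
  by case/connectP => p + ->; elim: p x => //= z p IHp x /andP[/v_r-> /IHp].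
(* The row of the root represents its whole component, so it alone carries the value of [v]
   there. *)
apply/submxP; exists
  (vec (fun x => if fingraph.roots r x then coef v x else 0)).
apply: coefP => x; rewrite coef_orbit_mx.
have [xA|xA] := boolP (x \in A); last first.
  rewrite v0 // big1 // => y /andP[yA /(closed_connect rA)].
  by rewrite yA (negPf xA).
rewrite (bigD1 (fingraph.root r x)) /=; last first.
  rewrite r_sym connect_root andbT.
  by rewrite -(closed_connect rA (connect_root r x)).
rewrite coef_vec roots_root // (v_con _ _ (connect_root r x)) big1 ?addr0 //.
move=> y /andP[/andP[yA yx] ne]; rewrite coef_vec; case: ifP => // /eqP ry.
by case/eqP: ne; rewrite -ry; apply/eqP; rewrite root_connect.
Qed.

(** Factoring the matrix through the roots in [A] bounds the rank from above; the minor on these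
    roots is the identity and bounds it from below. *)
Lemma rank_orbit_mx : \rank orbit_mx = n_comp r A.
Proof.
pose I := [predI fingraph.roots r & A]; pose n := #|I|.
have -> : n_comp r A = n by [].
pose B : 'M['F_2]_(n, #|T|) :=
  \matrix_(i, l) (connect r (enum_val i) (enum_val l))%:R.
pose L : 'M['F_2]_(#|T|, n) :=
  \matrix_(k, i)
    ((enum_val k \in A) && (fingraph.root r (enum_val k) == enum_val i))%:R.
pose L' : 'M['F_2]_(n, #|T|) := \matrix_(i, k) (enum_val k == enum_val i)%:R.
pose R' : 'M['F_2]_(#|T|, n) := \matrix_(k, i) (enum_val k == enum_val i)%:R.
apply/eqP; rewrite eqn_leq; apply/andP; split.
  suff -> : orbit_mx = L *m B.
    by apply: leq_trans (mxrankM_maxr _ _) (rank_leq_row _).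
  apply/matrixP => k l; rewrite !mxE.
  set x := enum_val k; set y := enum_val l.
  have [xA|xA] := boolP (x \in A); last first.
    by rewrite big1 // => i _; rewrite mxE -/x (negPf xA) mul0r.
  have xI : fingraph.root r x \in I.
    by rewrite !inE /= roots_root //= -(closed_connect rA (connect_root r x)).
  rewrite (bigD1 (enum_rank_in xI (fingraph.root r x))) //= big1 => [|i ne_i].
    rewrite !mxE -/x -/y xA enum_rankK_in // eqxx mul1r addr0.
    by rewrite (same_connect r_sym (connect_root r x)).
  rewrite mxE -/x xA /=; case: eqP => [eq_i|]; last by rewrite mul0r.
  by case/eqP: ne_i; apply: enum_val_inj; rewrite enum_rankK_in.
have LR : L' *m orbit_mx *m R' = 1%:M.
  apply/matrixP => i j; rewrite !mxE.
  have /andP[ri Ai] : enum_val i \in I := enum_valP i.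
  have /andP[rj Aj] : enum_val j \in I := enum_valP j.
  rewrite (bigD1 (enum_rank (enum_val j))) //= big1 => [|k ne_k]; last first.
    rewrite [R' _ _]mxE; case: eqP => [eq_k|]; last by rewrite mulr0.
    by case/eqP: ne_k; rewrite -eq_k enum_valK.
  rewrite !mxE enum_rankK eqxx mulr1 addr0.
  rewrite (bigD1 (enum_rank (enum_val i))) //= big1 => [|k ne_k]; last first.
    rewrite [L' _ _]mxE; case: eqP => [eq_k|]; last by rewrite mul0r.
    by case/eqP: ne_k; rewrite -eq_k enum_valK.
  rewrite !mxE !enum_rankK eqxx mul1r addr0 Ai /= -root_connect //.
  by rewrite (eqP ri) (eqP rj) (inj_eq enum_val_inj).
have <- : \rank (L' *m orbit_mx *m R') = n by rewrite LR mxrank1.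
by apply: leq_trans (mxrankM_maxl _ _) (mxrankM_maxr _ _).
Qed.

End OrbitSpace.

(** * Invariant functions on flags *)

Section FlagFlips.
Variable E : finType.
Implicit Types f : flag E.

Lemma flip_endK : involutive (@flip_end E).
Proof. by case=> [[e i] s]; rewrite /flip_end /= negbK. Qed.

Lemma flip_sideK : involutive (@flip_side E).
Proof. by case=> [[e i] s]; rewrite /flip_side /= negbK. Qed.

Lemma swap_end_sideK : involutive (@swap_end_side E).
Proof. by case=> [[e i] s]. Qed.

Lemma flip_end_free f : flip_end f != f.
Proof. by case: f => [[e i] s]; rewrite !xpair_eqE; case: i; rewrite andbF. Qed.

Lemma flip_side_free f : flip_side f != f.
Proof. by case: f => [[e i] s]; rewrite !xpair_eqE; case: s; rewrite andbF. Qed.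

End FlagFlips.

Section Invariants.
Variable E : finType.
Implicit Types (G : embgraph E) (e : E) (H P Q : {set E}) (f g : flag E).
Implicit Types w : flag E -> 'F_2.

(** These are the functions on the orbits counted by [orbits G P Q], extended by 0; orbit counts are
    compared through inclusions between such spaces. *)
Definition invariant G P Q w : Prop :=
  [/\ {in flags G, forall f, w (corner G f) = w f},
      {in flags G, forall f, edge_of f \in P -> w (flip_end f) = w f},
      {in flags G, forall f, edge_of f \in Q -> w (flip_side f) = w f}
    & forall f, f \notin flags G -> w f = 0].

Lemma invariant_sub G P Q P' Q' w :
  P' \subset P -> Q' \subset Q -> invariant G P Q w -> invariant G P' Q' w.
Proof.
move=> /subsetP sP /subsetP sQ [cw Pw Qw w0].
by split=> // f fG; [move/sP|move/sQ]; auto.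
Qed.

Lemma invariantM G P Q w1 w2 :
  invariant G P Q w1 -> invariant G P Q w2 ->
  invariant G P Q (fun f => w1 f * w2 f).
Proof.
move=> [cw Pw Qw w0] [cw' Pw' Qw' w0']; split=> f fG; last 1 first.
- by rewrite w0 ?mul0r.
- by rewrite cw ?cw'.
- by move=> fP; rewrite Pw ?Pw'.
by move=> fQ; rewrite Qw ?Qw'.
Qed.

Lemma eq_invariant G P Q w1 w2 :
  w1 =1 w2 -> invariant G P Q w1 -> invariant G P Q w2.
Proof.
move=> eqw [cw Pw Qw w0]; split=> f fG; rewrite -!eqw; auto.
Qed.

Variable G : embgraph E.
Hypothesis wfG : well_formed G.

Lemma corner_flags f : f \in flags G -> corner G f \in flags G.
Proof. by case: wfG => _ + _ _; apply. Qed.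

Lemma cornerK f : f \in flags G -> corner G (corner G f) = f.
Proof. by case: wfG => _ _ + _; apply. Qed.

Lemma corner_free f : f \in flags G -> corner G f != f.
Proof. by case: wfG => _ _ _; apply. Qed.

Lemma flip_end_flags f : (flip_end f \in flags G) = (f \in flags G).
Proof. by rewrite !inE. Qed.

Lemma flip_side_flags f : (flip_side f \in flags G) = (f \in flags G).
Proof. by rewrite !inE. Qed.

Lemma adj_sym P Q : ssrbool.symmetric (adj G P Q).
Proof.
suff imp f g : adj G P Q f g -> adj G P Q g f.
  by move=> f g; apply/idP/idP; apply: imp.
case/and3P=> fG gG; rewrite /adj fG gG /= => /or3P[/eqP->|/andP[fP /eqP->]|].
- by rewrite cornerK ?eqxx.
- by rewrite flip_endK eqxx fP orbT.
by case/andP=> fQ /eqP->; rewrite flip_sideK eqxx fQ !orbT.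
Qed.

Lemma adj_connect_sym P Q : connect_sym (adj G P Q).
Proof. by apply: sym_connect_sym; apply: adj_sym. Qed.

Lemma adj_closed P Q : closed (adj G P Q) (flags G).
Proof. by move=> f g /and3P[fG gG _]; rewrite fG gG. Qed.

Definition invariant_mx P Q := orbit_mx (adj G P Q) (flags G).

Lemma rank_invariant_mx P Q : \rank (invariant_mx P Q) = orbits G P Q.
Proof. apply: rank_orbit_mx; [apply: adj_connect_sym | apply: adj_closed]. Qed.

Lemma invariant_mxP P Q v :
  (v <= invariant_mx P Q)%MS <-> invariant G P Q (coef v).
Proof.
split=> [/(orbit_mxP (adj_connect_sym P Q) (@adj_closed P Q))[v_r v0]|].
  split=> // f fG => [|fP|fQ]; apply/esym/v_r; rewrite /adj fG.
  - by rewrite corner_flags //= eqxx.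
  - by rewrite flip_end_flags fG fP eqxx orbT.
  by rewrite flip_side_flags fG fQ eqxx !orbT.
move=> [cw Pw Qw w0].
apply/(orbit_mxP (adj_connect_sym P Q) (@adj_closed P Q)); split=> // f g.
case/and3P=> fG gG /or3P[/eqP->|/andP[fP /eqP->]|/andP[fQ /eqP->]].
- by rewrite cw.
- by rewrite Pw.
by rewrite Qw.
Qed.

Lemma invariant_mx_sub P Q P' Q' :
  (forall w, invariant G P' Q' w -> invariant G P Q w) ->
  (invariant_mx P' Q' <= invariant_mx P Q)%MS.
Proof.
by move=> sub; apply/rV_subP => v /invariant_mxP/sub ?; apply/invariant_mxP.
Qed.

Lemma orbits_leq P Q P' Q' :
  (forall w, invariant G P' Q' w -> invariant G P Q w) ->
  (orbits G P' Q' <= orbits G P Q)%N.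
Proof. by move=> /invariant_mx_sub/mxrankS; rewrite !rank_invariant_mx. Qed.

Lemma orbits_mono P Q P' Q' :
  P \subset P' -> Q \subset Q' -> (orbits G P' Q' <= orbits G P Q)%N.
Proof. by move=> sP sQ; apply: orbits_leq => w; apply: invariant_sub. Qed.

(** A subspace of full dimension is the whole space: an inequality between orbit counts yields
    additional invariance of each single function. *)
Lemma orbits_eq_invariant P Q P' Q' w :
  (forall w, invariant G P' Q' w -> invariant G P Q w) ->
  (orbits G P Q <= orbits G P' Q')%N ->
  invariant G P Q w -> invariant G P' Q' w.
Proof.
move=> /invariant_mx_sub sub; rewrite -!rank_invariant_mx => le_rank wPQ.
have := mxrank_leqif_sup sub; case=> le1; rewrite eqn_leq le1 le_rank => ge.
have vw : (vec w <= invariant_mx P Q)%MS.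
  apply/invariant_mxP.
  by apply: eq_invariant wPQ => f; rewrite coef_vec.
apply: (@eq_invariant _ _ _ (coef (vec w))) => [f|]; first by rewrite coef_vec.
by apply/invariant_mxP; apply: submx_trans vw _; rewrite -ge.
Qed.

(** The condition [w f = w g] is the vanishing of one linear form, hence cuts the dimension by at
    most 1. *)
Lemma orbits_codim1 P Q P' Q' f g :
  (forall w, invariant G P Q w -> w f = w g -> invariant G P' Q' w) ->
  (orbits G P Q <= (orbits G P' Q').+1)%N.
Proof.
move=> sub; rewrite -!rank_invariant_mx.
pose c : 'cV['F_2]_#|flag E| :=
  \col_k ((k == enum_rank f)%:R - (k == enum_rank g)%:R).
have vc v : v *m c = 0 -> coef v f = coef v g.
  move=> /matrixP/(_ 0 0); rewrite !mxE => v0.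
  apply/eqP; rewrite -subr_eq0 -{}v0; apply/eqP.
  under eq_bigr do rewrite mxE mulrBr.
  rewrite big_split /= sumrN; congr (_ - _).
    rewrite (bigD1 (enum_rank f)) //= eqxx mulr1 big1 ?addr0 // => i /negPf->.
    by rewrite mulr0.
  rewrite (bigD1 (enum_rank g)) //= eqxx mulr1 big1 ?addr0 // => i /negPf->.
  by rewrite mulr0.
rewrite -(mxrank_mul_ker _ c); apply: (@leq_add _ _ 1);
  first exact: rank_leq_col.
apply: mxrankS; apply/rV_subP => v; rewrite sub_capmx => /andP[vPQ /sub_kermxP].
by move/vc => vfg; apply/invariant_mxP/sub => //; apply/invariant_mxP.
Qed.

(** Apply dim U + dim W = dim (U + W) + dim (U ∩ W): the sum lies in the invariants of the smaller
    gluing, the intersection in those of the larger one. *)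
Lemma orbits_submod P Q P1 Q1 P2 Q2 P' Q' :
    P \subset P1 :&: P2 -> Q \subset Q1 :&: Q2 ->
    P' \subset P1 :|: P2 -> Q' \subset Q1 :|: Q2 ->
  (orbits G P1 Q1 + orbits G P2 Q2 <= orbits G P Q + orbits G P' Q')%N.
Proof.
rewrite !subsetI => /andP[sP1 sP2] /andP[sQ1 sQ2] /subsetP sP' /subsetP sQ'.
rewrite -!rank_invariant_mx -mxrank_sum_cap leq_add ?mxrankS //.
  rewrite addsmx_sub; apply/andP.
  by split; apply: invariant_mx_sub => w; apply: invariant_sub.
apply/rV_subP => v; rewrite sub_capmx => /andP[].
move=> /invariant_mxP[cw P1w Q1w w0] /invariant_mxP[_ P2w Q2w _].
apply/invariant_mxP; split=> // f fG.
  by move/sP'; rewrite inE => /orP[/P1w|/P2w]; apply.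
by move/sQ'; rewrite inE => /orP[/Q1w|/Q2w]; apply.
Qed.

Lemma invariant_component P Q f : f \in flags G ->
  invariant G P Q (fun g => (connect (adj G P Q) f g)%:R).
Proof.
move=> fG.
have step g h : adj G P Q g h ->
    connect (adj G P Q) f h = connect (adj G P Q) f g.
  move=> gh; rewrite !(adj_connect_sym _ _ f).
  apply/esym/same_connect; first exact: adj_connect_sym.
  exact: connect1.
split=> g gG => [|gP|gQ|].
- by rewrite (@step g) // /adj gG corner_flags //= eqxx.
- by rewrite (@step g) // /adj flip_end_flags gG gP eqxx orbT.
- by rewrite (@step g) // /adj flip_side_flags gG gQ eqxx !orbT.
case: (boolP (connect (adj G P Q) f g)) => //.
move=> /(closed_connect (@adj_closed P Q)).
by rewrite fG (negPf gG).
Qed.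

(** Indicator functions of components are invariant and separate the components. *)
Lemma connect_invariantP P Q f g : f \in flags G ->
  reflect (forall w, invariant G P Q w -> w f = w g) (connect (adj G P Q) f g).
Proof.
move=> fG; apply: (iffP idP) => [fg w [cw Pw Qw w0]|eq_w].
  case/connectP: fg => p + ->; elim: p f fG => //= h p IHp f fG.
  case/andP=> /and3P[_ hG ad] /(IHp _ hG) <-.
  by case/or3P: ad => [/eqP->|/andP[? /eqP->]|/andP[? /eqP->]];
    rewrite ?cw ?Pw ?Qw.
have := eq_w _ (invariant_component P Q fG); rewrite connect0.
by case: connect => // /eqP; rewrite oner_eq0.
Qed.

Lemma orbits1P P Q : orbits G P Q = 1%N ->
  forall w f g, invariant G P Q w ->
    f \in flags G -> g \in flags G -> w f = w g.
Proof.
rewrite /orbits /n_comp_mem => card1 w f g wPQ fG gG.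
have rootI h : h \in flags G ->
    fingraph.root (adj G P Q) h \in
      [predI fingraph.roots (adj G P Q) & flags G].
  move=> hG; rewrite !inE /= roots_root; last exact: adj_connect_sym.
  have := closed_connect (@adj_closed P Q) (connect_root (adj G P Q) h).
  by rewrite hG inE => <-.
suff fg : connect (adj G P Q) f g.
  by move/(connect_invariantP P Q g fG): fg; apply.
rewrite -root_connect; last exact: adj_connect_sym.
case/card1P: (introT eqP card1) => x eq_x; apply/eqP.
by move: (rootI _ fG) (rootI _ gG); rewrite !eq_x !inE => /eqP-> /eqP->.
Qed.

End Invariants.

(** * Parity of edges and an Euler inequality *)

Section EdgeFlips.
Variables (E : finType) (G : embgraph E).
Hypothesis wfG : well_formed G.
Implicit Types (e : E) (H P Q : {set E}) (f g : flag E) (w : flag E -> 'F_2).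
Local Notation S := (skel G).

Lemma mem_flags e i s : ((e, i, s) \in flags G) = (e \in S).
Proof. by rewrite inE. Qed.

Lemma invariant_end P Q w e s : e \in S -> e \in P ->
  invariant G P Q w -> w (e, false, s) = w (e, true, s).
Proof. by move=> eS eP [_ Pw _ _]; rewrite -(Pw (e, false, s)) ?mem_flags. Qed.

Lemma invariant_side P Q w e i : e \in S -> e \in Q ->
  invariant G P Q w -> w (e, i, false) = w (e, i, true).
Proof. by move=> eS eQ [_ _ Qw _]; rewrite -(Qw (e, i, false)) ?mem_flags. Qed.

Lemma invariant_addP P Q w e : invariant G P Q w ->
  (forall s, w (e, false, s) = w (e, true, s)) -> invariant G (e |: P) Q w.
Proof.
move=> [cw Pw Qw w0] we; split=> //= f fG; rewrite inE => /orP[];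
  last exact: Pw.
by rewrite /edge_of /flip_end; case: f {fG} => [[e' [] s]] /= /set1P ->.
Qed.

Lemma invariant_addQ P Q w e : invariant G P Q w ->
  (forall i, w (e, i, false) = w (e, i, true)) -> invariant G P (e |: Q) w.
Proof.
move=> [cw Pw Qw w0] we; split=> //= f fG; rewrite inE => /orP[];
  last exact: Qw.
by rewrite /edge_of /flip_side; case: f {fG} => [[e' i] []] /= /set1P ->.
Qed.

(** As the sides of [e] are already glued, gluing its ends is a single linear condition; it lowers
    the dimension unless every invariant function satisfies it, that is, unless the ends are
    connected. *)
Lemma orbits_addP P Q e : e \in S -> e \in Q ->
  orbits G P Q =
  (orbits G (e |: P) Q +
     ~~ connect (adj G P Q) (e, false, false) (e, true, false))%N.
Proof.
move=> eS eQ.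
have sP : P \subset e |: P by apply: subsetUr.
have fG : (e, false, false) \in flags G by rewrite mem_flags.
have codim w : invariant G P Q w -> w (e, false, false) = w (e, true, false) ->
    invariant G (e |: P) Q w.
  move=> wPQ w0; apply: invariant_addP => // [[]] //.
  by rewrite -!(invariant_side _ eS eQ wPQ).
case: connect_invariantP => //= [fg|nfg].
  rewrite addn0; apply/eqP; rewrite eqn_leq; apply/andP; split;
    last exact: orbits_mono.
  by apply: orbits_leq => // w wPQ; apply: codim => //; apply: fg.
rewrite addn1; apply/eqP; rewrite eqn_leq (orbits_codim1 wfG codim) /=.
rewrite ltnNge; apply/negP => le; case: nfg => w wPQ.
apply: (@invariant_end (e |: P) Q) => //; first by rewrite setU11.
by apply: (orbits_eq_invariant wfG _ le wPQ) => w'; apply: invariant_sub.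
Qed.

Lemma orbits_addQ P Q e : e \in S -> e \in P ->
  orbits G P Q =
  (orbits G P (e |: Q) +
     ~~ connect (adj G P Q) (e, false, false) (e, false, true))%N.
Proof.
move=> eS eP.
have sQ : Q \subset e |: Q by apply: subsetUr.
have fG : (e, false, false) \in flags G by rewrite mem_flags.
have codim w : invariant G P Q w -> w (e, false, false) = w (e, false, true) ->
    invariant G P (e |: Q) w.
  move=> wPQ w0; apply: invariant_addQ => // [[]] //.
  by rewrite -!(invariant_end _ eS eP wPQ).
case: connect_invariantP => //= [fg|nfg].
  rewrite addn0; apply/eqP; rewrite eqn_leq; apply/andP; split;
    last exact: orbits_mono.
  by apply: orbits_leq => // w wPQ; apply: codim => //; apply: fg.
rewrite addn1; apply/eqP; rewrite eqn_leq (orbits_codim1 wfG codim) /=.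
rewrite ltnNge; apply/negP => le; case: nfg => w wPQ.
apply: (@invariant_side P (e |: Q)) => //; first by rewrite setU11.
by apply: (orbits_eq_invariant wfG _ le wPQ) => w'; apply: invariant_sub.
Qed.

(* The union of the flags is cut open along e only, so that each component of *)
(* the gluing is a union of circles and of arcs, the ends of which are flags  *)
(* of e.                                                                      *)
Lemma sum_edge_flags P Q w e : e \in S -> S :\ e \subset P :|: Q ->
  invariant G P Q w ->
  w (e, false, false) + w (e, false, true) +
    (w (e, true, false) + w (e, true, true)) = 0.
Proof.
move=> eS /subsetP sPQ [cw Pw Qw w0].
have := @sum_free_involution _ (flags G) (corner G) w.
move=> /(_ (corner_flags wfG) (cornerK wfG) (corner_free wfG) cw).
rewrite (bigID (fun f => edge_of f == e)) /=.
rewrite [X in _ + X](_ : _ = 0) ?addr0 => [<-|]; last first.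
  (* Every edge other than [e] is glued along its ends or its sides; that gluing pairs off its
     flags, so they contribute 0. *)
  pose A := [set f in flags G | edge_of f != e].
  pose s f := if edge_of f \in P then flip_end f else flip_side f.
  transitivity (\sum_(f in A) w f); first by apply: eq_bigl => f; rewrite !inE.
  apply: (@sum_free_involution _ A s w).
  - by move=> f; rewrite !inE /s; case: ifP.
  - move=> f _; rewrite /s; have [fP|fP] := boolP (edge_of f \in P).
      by rewrite (_ : _ \in P = true) // flip_endK.
    by rewrite (_ : _ \in P = false) ?flip_sideK //; apply: negbTE.
  - move=> f _; rewrite /s.
    by case: ifP => _; rewrite ?flip_end_free ?flip_side_free.
  move=> f; rewrite !inE => /andP[fS fe].
  have fG : f \in flags G by rewrite inE.
  rewrite /s; case: ifPn => [/Pw->//|fP]; apply: Qw => //.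
  by have := sPQ (edge_of f); rewrite !inE fe fS (negPf fP) => /(_ isT).
rewrite (reindex_onto (fun p : bool * bool => (e, p.1, p.2))
                      (fun f => (f.1.2, f.2))) /=; last first.
  by move=> [[e' i] s] /andP[_ /eqP /= <-].
rewrite (eq_bigl xpredT) => [|[i s]]; last by rewrite !inE /= eS !eqxx.
rewrite -(pair_bigA _ (fun i s => w (e, i, s))) /= !big_bool /=.
by rewrite addrC ![w (_, _, true) + _]addrC.
Qed.

(** In the parity relation for [v * w] only the end of [e] where [v] is 1 survives, so [w] agrees on
    the two sides there; the relation for [w] then settles the other end. *)
Lemma ends_apart_sides_together P Q v w e : e \in S ->
  S :\ e \subset P :|: Q -> invariant G P Q v -> invariant G P Q w ->
  (forall i, v (e, i, false) = v (e, i, true)) ->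
  v (e, false, false) != v (e, true, false) ->
  forall i, w (e, i, false) = w (e, i, true).
Proof.
move=> eS sPQ vi wi v_side v_end.
have := sum_edge_flags eS sPQ (invariantM vi wi);
  have := sum_edge_flags eS sPQ wi.
rewrite -!v_side -!mulrDr (F2_neq v_end).
have [->|->] := F2_cases (v (e, true, false)).
  rewrite add0r mul1r mul0r addr0 => + w0; rewrite w0 add0r => w1 i.
  by apply/eqP; rewrite -F2_addr_eq0; case: i; rewrite ?w0 ?w1.
rewrite F2_addrr mul0r mul1r add0r => + w1; rewrite w1 addr0 => w0 i.
by apply/eqP; rewrite -F2_addr_eq0; case: i; rewrite ?w0 ?w1.
Qed.

Section AddEdge.
Variables (H : {set E}) (e : E).
Hypotheses (eS : e \in S) (eH : e \notin H).

Local Notation end0 := (e, false, false).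

Lemma b0_add : b0 G H =
  (b0 G (e |: H) + ~~ connect (adj G H S) end0 (e, true, false))%N.
Proof. exact: orbits_addP. Qed.

Lemma setD_add : S :\: H = e |: (S :\: (e |: H)).
Proof.
apply/setP => e'; rewrite !inE negb_or.
by case: eqP => [->|] //=; rewrite eS eH.
Qed.

Lemma b0_compl_add : b0_compl G (e |: H) =
  (b0_compl G H +
     ~~ connect (adj G S (S :\: (e |: H))) end0 (e, false, true))%N.
Proof. by rewrite /b0_compl setD_add; apply: orbits_addQ. Qed.

Lemma nb_boundary_add : (nb_boundary G (e |: H) <= (nb_boundary G H).+1)%N.
Proof.
apply: (orbits_codim1 (f := end0) (g := (e, false, true)) wfG) => w wi w0.
rewrite setD_add; apply: invariant_addQ.
  by apply: invariant_sub wi; rewrite ?subsetUr.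
by case=> //; rewrite -!(invariant_end _ eS _ wi) ?setU11.
Qed.

Section Bridge.
Hypothesis bridge : ~~ connect (adj G H S) end0 (e, true, false).

(** The indicator of the component of [H] at one end of [e] tells the two ends apart, so
    [ends_apart_sides_together] applies. *)
Lemma bridge_sides w : invariant G H (S :\: (e |: H)) w ->
  forall i, w (e, i, false) = w (e, i, true).
Proof.
move=> wi; pose v f := (connect (adj G H S) end0 f)%:R : 'F_2.
have vi : invariant G H S v by apply: invariant_component; rewrite ?mem_flags.
apply: (@ends_apart_sides_together H (S :\: (e |: H)) v) => //.
- apply/subsetP=> e'; rewrite !inE negb_or => /andP[-> ->].
  by rewrite andbT; apply: orbN.
- by apply: invariant_sub vi; rewrite ?subsetDl.
- by move=> i; apply: invariant_side vi.
by rewrite /v connect0 (negPf bridge).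
Qed.

Lemma bridge_not_separating : H \subset S ->
  connect (adj G S (S :\: (e |: H))) end0 (e, false, true).
Proof.
move=> HS; apply/connect_invariantP => // [|w wi]; first by rewrite mem_flags.
by apply: bridge_sides; apply: invariant_sub wi.
Qed.

(** By [bridge_sides], gluing along [e] only enlarges the invariance. If the counts agreed,
    functions constant on the components of [H] would take equal values at the two ends of [e],
    which would then be connected. *)
Lemma nb_boundary_bridge : (nb_boundary G (e |: H) < nb_boundary G H)%N.
Proof.
have sub w : invariant G (e |: H) (S :\: (e |: H)) w ->
    invariant G H (S :\: H) w.
  move=> wi; rewrite setD_add.
  have wi' : invariant G H (S :\: (e |: H)) w.
    by apply: invariant_sub wi; rewrite ?subsetUr.
  by apply: invariant_addQ (bridge_sides wi').
rewrite ltnNge; apply/negP => le; case/negP: bridge.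
apply/connect_invariantP => // [|w wi]; first by rewrite mem_flags.
apply: (@invariant_end (e |: H) (S :\: (e |: H))); rewrite ?setU11 //.
by apply: (orbits_eq_invariant wfG sub le); apply: invariant_sub wi;
  rewrite ?subsetDl.
Qed.

End Bridge.
End AddEdge.

(** This bounds the Euler characteristic of the capped neighbourhood by 2 per component. In the
    induction, an edge joining two components lowers both [b0] and the number of circles; any other
    edge adds at most one circle. *)
Lemma nb_boundary_le H : H \subset S ->
  (nb_vertices G + nb_boundary G H <= 2 * b0 G H + #|H|)%N.
Proof.
move: {2}#|H| (erefl #|H|) => n; elim: n H => [|n IHn] H cardH HS.
  rewrite (cards0_eq cardH) cards0 /nb_boundary setD0.
  by rewrite /nb_vertices /b0; lia.
have /card_gt0P[e eH] : (0 < #|H|)%N by rewrite cardH.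
have eS : e \in S := subsetP HS e eH.
have eH' : e \notin H :\ e by rewrite setD11.
have defH := setD1K eH.
have cardH' : #|H :\ e| = n.
  by have := cardsD1 e H; rewrite eH cardH add1n => -[].
have := IHn _ cardH' (subset_trans (subD1set _ _) HS).
have := b0_add (H :\ e) eS; rewrite defH.
have := nb_boundary_add eS eH'; rewrite defH.
have := nb_boundary_bridge eS eH'; rewrite defH cardH cardH'.
by case: connect => /= [_|/(_ isT)]; lia.
Qed.

End EdgeFlips.

(** * Duality and subgraphs of the projective plane *)

Section Duality.
Variables (E : finType) (G : embgraph E).
Hypothesis wfG : well_formed G.
Implicit Types (H P Q : {set E}) (f g : flag E).
Local Notation S := (skel G).

Lemma swap_flags f : (swap_end_side f \in flags G) = (f \in flags G).
Proof. by rewrite !inE. Qed.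

Lemma well_formed_dual : well_formed (dual_decomposition G).
Proof.
have swapG f : f \in flags G -> swap_end_side f \in flags G.
  by rewrite swap_flags.
case: wfG => sub _ _ _; split=> //= f fG.
- by rewrite swap_flags corner_flags ?swapG.
- by rewrite swap_end_sideK cornerK ?swapG // swap_end_sideK.
by rewrite (can2_eq (@swap_end_sideK E) (@swap_end_sideK E)) corner_free ?swapG.
Qed.

Lemma adj_dual P Q f g :
  adj (dual_decomposition G) P Q f g =
  adj G Q P (swap_end_side f) (swap_end_side g).
Proof.
rewrite /adj !swap_flags.
rewrite -[g == _](can2_eq (@swap_end_sideK E) (@swap_end_sideK E)).
rewrite -(inj_eq (inv_inj (@swap_end_sideK E)) g (flip_side f)).
rewrite -(inj_eq (inv_inj (@swap_end_sideK E)) g (flip_end f)).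
by congr [&& _, _ & _ || _]; rewrite orbC.
Qed.

(** Exchanging ends and sides is an isomorphism between the two gluings. *)
Lemma orbits_dual P Q : orbits (dual_decomposition G) P Q = orbits G Q P.
Proof.
pose h := @swap_end_side E.
have closedD : closed (adj (dual_decomposition G) P Q) (flags G).
  exact: (@adj_closed _ (dual_decomposition G)).
have hI : injective h := inv_inj (@swap_end_sideK E).
rewrite /orbits (@adjunction_n_comp _ _ h _ (adj G Q P)).
- by apply: eq_n_comp_r => f; rewrite inE /= swap_flags.
- exact: adj_connect_sym well_formed_dual _ _.
- exact: adj_connect_sym.
- exact: closedD.
apply: strict_adjunction => //; first exact: adj_connect_sym.
- by apply/subsetP => f _; apply/codomP; exists (h f);
  rewrite /h swap_end_sideK.
by move=> f g _; rewrite /h adj_dual !swap_end_sideK.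
Qed.

Lemma nb_vertices_dual : nb_vertices (dual_decomposition G) = nb_faces G.
Proof. exact: orbits_dual. Qed.

Lemma nb_faces_dual : nb_faces (dual_decomposition G) = nb_vertices G.
Proof. exact: orbits_dual. Qed.

Lemma b0_dual H : H \subset S ->
  b0 (dual_decomposition G) (S :\: H) = b0_compl G H.
Proof. by move=> HS; apply: orbits_dual. Qed.

Lemma b0_compl_dual H : H \subset S ->
  b0_compl (dual_decomposition G) (S :\: H) = b0 G H.
Proof.
move=> HS; apply: etrans (orbits_dual _ _) _.
by rewrite setDDr setDv set0U (setIidPr HS).
Qed.

Lemma nb_boundary_dual H : H \subset S ->
  nb_boundary (dual_decomposition G) (S :\: H) = nb_boundary G H.
Proof.
move=> HS; apply: etrans (orbits_dual _ _) _.
by rewrite setDDr setDv set0U (setIidPr HS).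
Qed.

End Duality.

(** * Counting identities for subgraphs of the projective plane *)

Section ProjectivePlane.
Variables (E : finType) (G : embgraph E).
Hypothesis planeG : in_RP2 G.
Implicit Types (e : E) (H P Q : {set E}) (f g : flag E) (w : flag E -> 'F_2).
Local Notation S := (skel G).

Let wfG : well_formed G. Proof. by case: planeG. Qed.

Lemma euler_RP2 : (nb_vertices G + nb_faces G = #|S| + 1)%N.
Proof. by case: planeG => _ _; rewrite /euler_surface; lia. Qed.

Lemma in_RP2_dual : in_RP2 (dual_decomposition G).
Proof.
case: planeG => _ conn chi.
have wfD : well_formed (dual_decomposition G) := well_formed_dual wfG.
have connD : orbits (dual_decomposition G) S S = 1%N by rewrite orbits_dual.
split; first exact wfD.
  exact connD.
have eS : skel (dual_decomposition G) = S by [].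
apply: etrans chi;
  rewrite /euler_surface (nb_vertices_dual wfG) (nb_faces_dual wfG) eS.
by rewrite [LHS]addrC [LHS]addrA [LHS]addrAC.
Qed.

Lemma orbits_connected w f g : invariant G S S w ->
  f \in flags G -> g \in flags G -> w f = w g.
Proof. by case: planeG => _ /(orbits1P wfG) + _; apply. Qed.

Lemma b0_skel : b0 G S = 1%N. Proof. by case: planeG. Qed.

Lemma b0_compl0 : b0_compl G set0 = 1%N.
Proof. by rewrite /b0_compl setD0; case: planeG. Qed.

Lemma nb_boundary_compl_le H : H \subset S ->
  (nb_faces G + nb_boundary G H <= 2 * b0_compl G H + #|S :\: H|)%N.
Proof.
move=> HS; have := nb_boundary_le (well_formed_dual wfG) (subsetDl S H).
by rewrite (nb_vertices_dual wfG) (nb_boundary_dual wfG HS) (b0_dual wfG HS).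
Qed.

(** Submodularity, with a connected surface as the full gluing, gives one inequality. For the other,
    [nb_boundary_le] for [H] and for its dual add up, by the Euler characteristic, to 2 bd + 1 <= 2
    (b0 + b0_compl), and parity improves 1 to 2. *)
Lemma nb_boundary_RP2 H : H \subset S ->
  ((nb_boundary G H).+1 = b0 G H + b0_compl G H)%N.
Proof.
move=> HS; have := nb_boundary_le wfG HS; have := nb_boundary_compl_le HS.
have sub : (b0 G H + b0_compl G H <= nb_boundary G H + orbits G S S)%N.
  apply: (orbits_submod wfG); rewrite ?subsetI ?subxx ?subsetDl ?HS //.
    by rewrite subsetUr.
  by rewrite subsetUl.
rewrite -[orbits G S S]/(b0 G S) b0_skel in sub.
have := euler_RP2; have := cardsID H S; rewrite (setIidPr HS).
lia.
Qed.

(* H contains a cycle of nonzero homology class. *)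
Definition essential H : bool :=
  (nb_vertices G + b0_compl G H < #|H| + b0 G H + 1)%N.

(** Once [nb_boundary_RP2] removes the boundary circles, the bound [nb_boundary_le] for [H] and its
    dual confine the difference to 0 or 1. *)
Lemma essentialE H : H \subset S ->
  (#|H| + b0 G H + 1 = nb_vertices G + b0_compl G H + essential H)%N.
Proof.
move=> HS; have := nb_boundary_le wfG HS; have := nb_boundary_compl_le HS.
have := nb_boundary_RP2 HS.
have := euler_RP2; have := cardsID H S; rewrite (setIidPr HS).
rewrite /essential; case: ltnP => /=; lia.
Qed.

Lemma s_expE H : H \subset S -> s_exp G H = essential H.
Proof.
move=> HS; have := essentialE HS; have := nb_boundary_RP2 HS.
rewrite /s_exp /euler_capped; case: essential => /=; lia.
Qed.

Lemma s_perp_expE H : H \subset S -> s_perp_exp G H = ~~ essential H.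
Proof.
move=> HS; have := essentialE HS; have := nb_boundary_RP2 HS.
have := euler_RP2; have := cardsID H S; rewrite (setIidPr HS).
rewrite /s_perp_exp /euler_capped_compl; case: essential => /=; lia.
Qed.

(** A new edge between two components lowers [b0] and does not cut the complement; any other edge
    leaves [b0] alone and adds at most one component to the complement. In neither case does the
    excess in [essentialE] drop. *)
Lemma essential_add e H : e \in S -> e \notin H -> H \subset S ->
  essential H -> essential (e |: H).
Proof.
move=> eS eH HS; have eHS : e |: H \subset S by rewrite subUset sub1set eS.
move=> esH; move: (essentialE HS) (essentialE eHS); rewrite esH cardsU1 eH /=.
move: (b0_add wfG H eS) (b0_compl_add wfG eS eH).
have := @bridge_not_separating _ _ wfG H e eS.
case: essential => [//|].
case: connect => /= [_|/(_ isT HS) ->]; last by lia.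
by case: (connect (adj G S _)) => /=; lia.
Qed.

Lemma essential_sub H (K : {set E}) : H \subset K -> K \subset S ->
  essential H -> essential K.
Proof.
move: {2}#|K| (leqnn #|K|) => n; elim: n K => [|n IHn] K leK HK KS esH.
  move: leK; rewrite leqn0 cards_eq0 => /eqP K0.
  by move: HK; rewrite K0 subset0 => /eqP <-.
have [<-//|neHK] := eqVneq H K.
have /properP[_ [e eK eH]] : H \proper K by rewrite properEneq neHK.
have KeS : K :\ e \subset S := subset_trans (subD1set K e) KS.
have eKe : e \notin K :\ e by rewrite setD11.
have HKe : H \subset K :\ e by rewrite subsetD1 HK.
have leKe : (#|K :\ e| <= n)%N by have := cardsD1 e K; rewrite eK; lia.
rewrite -(setD1K eK).
exact: essential_add (subsetP KS e eK) eKe KeS (IHn _ leKe HKe KeS esH).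
Qed.

End ProjectivePlane.

(** * Homology *)

Section Homology.
Variables (E : finType) (G : embgraph E).
Hypothesis planeG : in_RP2 G.
Implicit Types (e : E) (H P Q : {set E}) (f g : flag E) (w : flag E -> 'F_2).
Local Notation S := (skel G).

Let wfG : well_formed G. Proof. by case: planeG. Qed.

(** This is the boundary map on 2-chains viewed as functions constant on faces; one end of each edge
    suffices, as such functions are invariant under [flip_end]. *)
Definition side_sum_mx : 'M['F_2]_(#|flag E|, #|E|) :=
  \matrix_(k, j) \sum_(s : bool) (enum_val k == (enum_val j, false, s))%:R.

Lemma coef_side_sum_mx v e : coef (v *m side_sum_mx) e =
  coef v (e, false, false) + coef v (e, false, true).
Proof.
rewrite coefM; under eq_bigr => k _ do rewrite mxE enum_rankK mulr_sumr.
rewrite exchange_big big_bool /= addrC.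
have sum1 f : \sum_(k : 'I_#|flag E|) v 0 k * (enum_val k == f)%:R = coef v f.
  rewrite (bigD1 (enum_rank f)) //= enum_rankK eqxx mulr1 big1 ?addr0 // => k.
  by case: (enum_val k =P f) => [<-|_ _]; rewrite ?enum_valK ?eqxx ?mulr0.
by rewrite !sum1.
Qed.

Lemma bd2E : bd2 G = invariant_mx G S set0 *m side_sum_mx.
Proof.
apply/row_matrixP => k; rewrite row_mul; apply: coefP => e.
rewrite coef_side_sum_mx /coef !mxE !enum_rankK.
case: ifP => kG; last by rewrite addr0.
by rewrite big_bool /= natrD addrC.
Qed.

Lemma bd2P v : reflect
  (exists2 w, invariant G S set0 w &
     forall e, coef v e = w (e, false, false) + w (e, false, true))
  (v <= bd2 G)%MS.
Proof.
rewrite bd2E; apply: (iffP idP) => [/submxP[u ->]|[w wi v_w]].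
  exists (coef (u *m invariant_mx G S set0)).
    by apply/invariant_mxP => //; apply: submxMl.
  by move=> e; rewrite mulmxA coef_side_sum_mx.
have -> : v = vec w *m side_sum_mx.
  by apply: coefP => e; rewrite coef_side_sum_mx !coef_vec.
apply: submxMr; apply/invariant_mxP => //.
by apply: eq_invariant wi => f; rewrite coef_vec.
Qed.

Lemma chains1P H v : reflect (forall e, e \notin H -> coef v e = 0)
  (v <= chains1 H)%MS.
Proof.
have coef1 u e : coef (u *m chains1 H) e = coef u e * (e \in H)%:R.
  rewrite coefM (bigD1 (enum_rank e)) //= mxE enum_rankK eqxx big1 ?addr0 //.
  by move=> k /negPf ne; rewrite mxE ne mulr0.
apply: (iffP submxP) => [[u ->] e eH|v0];
  first by rewrite coef1 (negPf eH) mulr0.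
exists v; apply: coefP => e; rewrite coef1.
by case: (boolP (e \in H)) => [|/v0->]; rewrite ?mulr1 ?mul0r.
Qed.

Lemma sum_flags (F : flag E -> 'F_2) :
  \sum_f F f = \sum_e \sum_(i : bool) \sum_(s : bool) F (e, i, s).
Proof. by rewrite !pair_bigA /=; apply: eq_bigr => [[[e i] s]]. Qed.

(** This is the vanishing of the boundary of a boundary: the sum is that of the face function times
    the indicator of a vertex over all flags, which [corner] pairs off. *)
Lemma face_vertex_even w g : invariant G S set0 w ->
  \sum_e (w (e, false, false) + w (e, false, true)) *
    (\sum_(i : bool) connect (vertex_adj G) g (e, i, false))%:R = 0.
Proof.
move=> wi; pose b f := (connect (vertex_adj G) g f)%:R : 'F_2.
have [gG|gG] := boolP (g \in flags G); last first.
  apply: big1 => e _; have [eS|eS] := boolP (e \in S).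
    rewrite big1 ?mulr0 // => i _; apply/eqP; rewrite eqb0.
    apply: contra gG => /(closed_connect (@adj_closed _ _ _ _))->.
    by rewrite mem_flags.
  by case: wi => _ _ _ w0; rewrite !w0 ?mem_flags // addr0 mul0r.
have bi : invariant G set0 S b by apply: invariant_component.
have [cw _ _ w0] := wi; have [cb _ _ _] := bi.
transitivity (\sum_(f in flags G) w f * b f); last first.
  apply: (@sum_free_involution _ _ (corner G)).
  - exact: corner_flags.
  - exact: cornerK.
  - exact: corner_free.
  by move=> f fG; rewrite cw ?cb.
rewrite [RHS]big_mkcond /=.
rewrite sum_flags.
apply: eq_bigr => e _; rewrite !big_bool /= !mem_flags.
case: ifP => eS; last by rewrite !w0 ?mem_flags ?eS // !addr0 mul0r.
rewrite -!(invariant_end _ eS eS wi) -!(invariant_side _ eS eS bi).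
rewrite natrD -/(b _) -/(b _); ring.
Qed.

Lemma bd2_cycle : (bd2 G <= kermx (bd1 G))%MS.
Proof.
apply/rV_subP => v /bd2P[w wi v_w]; apply/sub_kermxP; apply: coefP => g.
rewrite coefM /coef mxE -[RHS](face_vertex_even g wi).
rewrite (reindex enum_rank) /=; last first.
  by apply: onW_bij; apply: enum_rank_bij.
by apply: eq_bigr => e _; rewrite -v_w mxE !enum_rankK.
Qed.

(** A boundary is supported on [H] when its face function does not change across the other edges,
    i.e. is a function on the components of the complement. Only constants have zero boundary,
    whence the shift by 1. *)
Lemma dim_ker_inclE H : H \subset S -> (dim_ker_incl G H).+1 = b0_compl G H.
Proof.
move=> HS; pose X := invariant_mx G S (S :\: H).
have -> : dim_ker_incl G H = \rank (X *m side_sum_mx).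
  apply: eqmx_rank; apply/andP; split; apply/rV_subP => v.
    rewrite !sub_capmx => /andP[/andP[/chains1P vH _] /bd2P[w wi v_w]].
    have -> : v = vec w *m side_sum_mx.
      by apply: coefP => e; rewrite coef_side_sum_mx !coef_vec.
    apply: submxMr; apply/invariant_mxP => //.
    apply: (@eq_invariant _ _ _ _ w) => [f|]; first by rewrite coef_vec.
    have [cw Sw _ w0] := wi; split=> //.
    move=> [[e i] s] fG; rewrite inE /edge_of /flip_side /= => /andP[eH eS].
    apply/eqP; rewrite -F2_addr_eq0; move/vH: eH; rewrite v_w => <-.
    case: i {fG}; rewrite -?(invariant_end _ eS eS wi).
      by case: s => /=; rewrite // addrC.
    by case: s => /=; rewrite // addrC.
  move=> /submxP[u ->]; rewrite mulmxA.
  have /(invariant_mxP wfG) wi : (u *m X <= X)%MS by apply: submxMl.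
  set w := coef _ in wi.
  have inbd2 : (u *m X *m side_sum_mx <= bd2 G)%MS.
    apply/bd2P; exists w; last by move=> e; rewrite coef_side_sum_mx.
    by apply: invariant_sub wi; rewrite ?sub0set.
  rewrite !sub_capmx inbd2 (submx_trans inbd2 bd2_cycle) !andbT.
  apply/chains1P => e eH; rewrite coef_side_sum_mx -/w.
  have [eS|eS] := boolP (e \in S).
    by rewrite (invariant_side _ eS _ wi) ?inE ?eH // F2_addrr.
  by case: wi => _ _ _ w0; rewrite !w0 ?mem_flags // addr0.
(* Rank-nullity on [X]: the kernel consists of the functions invariant under all gluings, of
   dimension [b0 G S = 1]. *)
have := mxrank_mul_ker X side_sum_mx; rewrite rank_invariant_mx //.
rewrite -[orbits G S (S :\: H)]/(b0_compl G H) => <-.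
rewrite -[LHS]addn1; congr (_ + _)%N; apply/esym.
apply: etrans (b0_skel planeG); apply: etrans (rank_invariant_mx wfG S S).
apply: eqmx_rank; apply/andP; split; apply/rV_subP => v.
  rewrite sub_capmx => /andP[/(invariant_mxP wfG) vi /sub_kermxP v0].
  apply/invariant_mxP => //; have [cv Sv _ v00] := vi; split=> //.
  move=> [[e i] s] fG; rewrite /edge_of /flip_side /= => eS.
  have := coef_side_sum_mx v e; rewrite v0 /coef mxE -!/(coef v _) => /esym/eqP.
  rewrite F2_addr_eq0 => /eqP eq_s.
  by case: i {fG}; rewrite -?(invariant_end _ eS eS vi); case: s.
move=> /(invariant_mxP wfG) vi; rewrite sub_capmx; apply/andP; split.
  by apply/invariant_mxP => //; apply: invariant_sub vi; rewrite ?subsetDl.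
apply/sub_kermxP; apply: coefP => e; rewrite coef_side_sum_mx /coef [RHS]mxE.
rewrite -!/(coef v _); have [eS|eS] := boolP (e \in S).
  by rewrite (invariant_side _ eS eS vi) F2_addrr.
by case: vi => _ _ _ w0; rewrite !w0 ?mem_flags // addr0.
Qed.

(** A 2-chain bounding [e] is a face function that changes across [e] and across no other edge; it
    exists when cutting along [e] separates its sides. *)
Lemma null_homologousE e : e \in S ->
  null_homologous G e =
  ~~ connect (adj G S (S :\ e)) (e, false, false) (e, false, true).
Proof.
move=> eS; have fG : (e, false, false) \in flags G by rewrite mem_flags.
have delta e' : coef (delta_mx (0 : 'I_1) (enum_rank e)) e' = (e' == e)%:R.
  by rewrite /coef mxE eqxx (inj_eq enum_rank_inj).
apply/bd2P/idP => [[w wi w_e]|sep].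
  apply/negP => /(connect_invariantP wfG _ _ _ fG)/(_ w) eq_w.
  have := w_e e; rewrite delta eqxx eq_w ?F2_addrr //.
  have [cw Sw _ w0] := wi; split=> //.
  move=> [[e' i] s] gG; rewrite !inE /edge_of /flip_side /= => /andP[ne eS'].
  have := w_e e'; rewrite delta (negPf ne) => /esym/eqP; rewrite F2_addr_eq0.
  move=> /eqP eq_s.
  by case: i {gG}; rewrite -?(invariant_end _ eS' eS' wi); case: s.
exists (fun f => (connect (adj G S (S :\ e)) (e, false, false) f)%:R).
  have := invariant_component wfG S (S :\ e) fG.
  by apply: invariant_sub; rewrite ?sub0set.
have wi := invariant_component wfG S (S :\ e) fG.
move=> e'; rewrite delta; case: eqP => [->|/eqP ne].
  by rewrite connect0 (negPf sep) addr0.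
have [eS'|eS'] := boolP (e' \in S).
  by rewrite (invariant_side _ eS' _ wi) ?F2_addrr // !inE ne.
by case: wi => _ _ _ w0; rewrite !w0 ?mem_flags // addr0.
Qed.

End Homology.

(** * Contraction of a forest *)

Lemma head_filter_default (T : Type) (p : pred T) (s : seq T) x y :
  has p s -> head x (filter p s) = head y (filter p s).
Proof. by elim: s => //= a s IHs; case: (p a). Qed.

Section Contraction.
Variables (E : finType) (G : embgraph E) (C : {set E}).
Hypothesis planeG : in_RP2 G.
Local Notation S := (skel G).
Hypothesis CS : C \subset S.
Hypothesis forestC : (#|C| + b0 G C = nb_vertices G)%N.
Implicit Types (e : E) (H P Q : {set E}) (f g h : flag E) (w : flag E -> 'F_2).
Local Notation G' := (contract_set G C).

Let wfG : well_formed G. Proof. by case: planeG. Qed.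

(* A neighbourhood of a forest is a union of discs, each of which has a       *)
(* single boundary circle.                                                    *)
Lemma forest_invariant P Q w : C \subset P -> S :\: C \subset Q ->
  invariant G P Q w -> invariant G P S w.
Proof.
move=> CP CQ wi; have [cw Pw _ w0] := wi; split=> //.
suff [] : invariant G C S w by [].
apply: (@orbits_eq_invariant _ _ wfG C (S :\: C)) => [w'| |].
- by apply: invariant_sub; rewrite ?subsetDl.
(* With [forestC] this bound becomes [nb_boundary G C <= b0 G C]. *)
- have := nb_boundary_le wfG CS; rewrite /nb_boundary /b0.
  move: forestC; rewrite /b0; lia.
by apply: invariant_sub wi.
Qed.

Lemma orbits_forest P Q : C \subset P -> S :\: C \subset Q -> Q \subset S ->
  orbits G P Q = orbits G P S.
Proof.
move=> CP CQ QS; apply/eqP; rewrite eqn_leq; apply/andP; split.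
  by apply: orbits_leq => // w; apply: forest_invariant.
exact: orbits_mono.
Qed.

(** If the whole 1-skeleton were a tree, the Euler characteristic 1 would leave no faces. *)
Lemma forest_proper : exists2 e, e \in S & e \notin C.
Proof.
have /properP[_ //] : C \proper S.
rewrite properEneq CS andbT; apply/eqP => eqCS.
have := euler_RP2 planeG; have := b0_skel planeG.
have : (orbits G S S <= nb_faces G)%N by apply: orbits_mono; rewrite ?sub0set.
have := forestC; rewrite eqCS /b0; lia.
Qed.

Definition turn g := corner G (flip_end g).

Lemma turn_flags g : g \in flags G -> turn g \in flags G.
Proof. by move=> gG; apply: corner_flags; rewrite ?flip_end_flags. Qed.

Lemma iter_turn_flags n g : g \in flags G -> iter n turn g \in flags G.
Proof. by move=> gG; elim: n => //= n /turn_flags. Qed.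

Lemma turn_inj : {in flags G &, injective turn}.
Proof.
move=> g h gG hG /(congr1 (corner G)).
by rewrite !(cornerK wfG) ?flip_end_flags // => /(inv_inj (@flip_endK E)).
Qed.

(** Otherwise a whole face would have all its edges in [C]. Its indicator would be invariant under
    the gluings of the neighbourhood of the forest, hence by [forest_invariant] under all gluings,
    hence constant, although it vanishes on an edge outside [C]. *)
Lemma turn_exits g : g \in flags G ->
  exists2 h, fconnect turn g h & edge_of h \notin C.
Proof.
move=> gG; have [/existsP[h /andP[]]|/existsPn noh] :=
  boolP [exists h, fconnect turn g h && (edge_of h \notin C)];
    first by exists h.
have inC h : fconnect turn g h -> edge_of h \in C.
  by move=> gh; have := noh h; rewrite gh negbK.
pose A := [set h | fconnect turn g h].
have AG h : h \in A -> h \in flags G.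
  by rewrite inE => /iter_findex <-; apply: iter_turn_flags.
have turnA : turn @: A = A.
  apply/eqP; rewrite eqEcard card_in_imset ?leqnn ?andbT; last first.
    by move=> h h' /AG hG /AG; apply: turn_inj.
  apply/subsetP => _ /imsetP[h hA ->]; move: hA; rewrite !inE => gh.
  exact: connect_trans gh (fconnect1 _ _).
(* The walk visits every other flag of the face; the corners of these supply the rest. *)
pose O := A :|: corner G @: A.
have OG h : h \in O -> h \in flags G.
  by case/setUP => [/AG|/imsetP[k /AG kG ->]] //; apply: corner_flags.
have OC h : h \in O -> edge_of h \in C.
  case/setUP => [|/imsetP[k kA ->]]; first by rewrite inE => /inC.
  move: kA; rewrite -turnA => /imsetP[l lA ->]; rewrite /turn (cornerK wfG).
    by rewrite inE in lA; apply: inC lA.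
  by rewrite flip_end_flags AG.
have cO h : h \in O -> corner G h \in O.
  case/setUP => [hA|/imsetP[k kA ->]]; rewrite inE.
    by rewrite imset_f // orbT.
  by rewrite (cornerK wfG) ?kA // AG.
have feO h : h \in O -> flip_end h \in O.
  case/setUP => [hA|/imsetP[k kA ->]]; rewrite inE; apply/orP; [right|left].
    apply/imsetP; exists (turn h); first by rewrite -turnA imset_f.
    by rewrite /turn (cornerK wfG) ?flip_end_flags ?AG.
  rewrite -turnA in kA; case/imsetP: kA => l lA ->.
  by rewrite /turn (cornerK wfG) ?flip_endK ?flip_end_flags ?AG.
pose w h : 'F_2 := (h \in O)%:R.
have wi : invariant G C (S :\: C) w.
  split=> [k hG|k hG hC|k hG|k hG]; rewrite /w.
  - congr (_ : bool)%:R; apply/idP/idP => [/cO|]; last exact: cO.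
    by rewrite (cornerK wfG).
  - congr (_ : bool)%:R; apply/idP/idP => [/feO|]; last exact: feO.
    by rewrite flip_endK.
  - rewrite inE => /andP[hC _]; have [/OC|_] := boolP (k \in O).
      by rewrite (negPf hC).
    have [/OC|//] := boolP (flip_end k \in O).
      by rewrite /edge_of /= (negPf hC).
    by have [/OC|//] := boolP (flip_side k \in O);
      rewrite /edge_of /= (negPf hC).
  by have [/OG|//] := boolP (k \in O); rewrite (negPf hG).
have wS : invariant G S S w.
  have [cw Cw Sw w0] := forest_invariant (subxx C) (subxx _) wi.
  split=> // h hG hS; have [hC|hC] := boolP (edge_of h \in C); first exact: Cw.
  have [/OC|_] := boolP (h \in O); first by rewrite (negPf hC).
  rewrite /w; have [/OC|] := boolP (flip_end h \in O).
    by rewrite /edge_of /= (negPf hC).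
  by have [/OC|//] := boolP (h \in O); rewrite (negPf hC).
have [e eS eC] := forest_proper.
have eG : (e, false, false) \in flags G by rewrite mem_flags.
have := orbits_connected planeG wS gG eG.
have gO : g \in O by rewrite !inE connect0.
rewrite /w gO; have [/OC|_ /eqP] := boolP ((e, false, false) \in O).
  by rewrite /edge_of /= (negPf eC).
by rewrite oner_eq0.
Qed.

Definition exit g :=
  head g [seq h <- traject turn g #|flag E| | edge_of h \notin C].

Lemma turn_exits_bound g : g \in flags G ->
  has (fun h => edge_of h \notin C) (traject turn g #|flag E|).
Proof.
move=> /turn_exits[h gh hC]; apply/hasP; exists h => //.
apply/trajectP; exists (findex turn g h); last by rewrite iter_findex.
by apply: leq_trans (findex_max gh) (max_card _).
Qed.

Lemma card_flag g : #|flag E| = #|flag E|.-1.+1.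
Proof. by rewrite prednK //; apply/card_gt0P; exists g. Qed.

Lemma exit_out g : edge_of g \notin C -> exit g = g.
Proof. by move=> gC; rewrite /exit (card_flag g) /= gC. Qed.

Lemma exit_turn g : g \in flags G -> edge_of g \in C -> exit g = exit (turn g).
Proof.
move=> gG gC; have := turn_exits_bound gG.
(* The walk from [turn g] has one extra last entry, which is harmless because an exit occurs
   earlier. *)
rewrite /exit (card_flag g) !(trajectS turn g) trajectSr /= gC /=.
rewrite filter_rcons => out.
rewrite (head_filter_default g (turn g)) //.
by case: ifP => // _; move: out; rewrite has_filter; case: filter.
Qed.

Lemma exit_ind (R : flag E -> Prop) :
  (forall g, g \in flags G -> edge_of g \notin C -> R g) ->
  (forall g, g \in flags G -> edge_of g \in C -> R (turn g) -> R g) ->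
  forall g, g \in flags G -> R g.
Proof.
move=> R_out R_turn g gG; have [h gh] := turn_exits gG.
rewrite -(iter_findex gh); move: (findex _ _ _) => n {h gh}.
elim: n g gG => [|n IHn] g gG; first exact: R_out.
have [gC|gC _] := boolP (edge_of g \in C); last exact: R_out.
by rewrite iterSr => /IHn turnR; apply: R_turn => //; apply/turnR/turn_flags.
Qed.

Lemma mem_flags_contract f :
  (f \in flags G') = (edge_of f \notin C) && (f \in flags G).
Proof. by rewrite !inE. Qed.

Lemma exit_flags g : g \in flags G -> exit g \in flags G'.
Proof.
move: g; apply: exit_ind => g gG gC; last by rewrite (exit_turn gG gC).
by rewrite exit_out // mem_flags_contract gC.
Qed.

Lemma contract_cornerE f : f \in flags G -> corner G' f = exit (corner G f).
Proof.
move=> fG; apply: head_filter_default.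
exact/turn_exits_bound/corner_flags.
Qed.

(* The exit of the corner of g is reached from g by turning backwards.        *)
Lemma contract_corner_exit g : g \in flags G ->
  corner G' (exit g) = exit (corner G g).
Proof.
move: g; apply: exit_ind => g gG gC.
  by rewrite exit_out // contract_cornerE.
rewrite -(exit_turn gG gC) => ->;
  rewrite /turn (cornerK wfG) ?flip_end_flags //.
by rewrite exit_turn ?flip_end_flags // /turn flip_endK.
Qed.

(** Dropping the first and last steps of such a walk gives one shorter by two for
    [flip_end (corner G f)]; the shortest cases contradict the freeness of [corner] and [flip_end].
    This keeps the contracted corner map free. *)
Lemma iter_turn_corner n f : f \in flags G -> iter n turn (corner G f) != f.
Proof.
elim/ltn_ind: n f => [[|[|n]] IHn] f fG; first exact: corner_free.
  apply/eqP => /(congr1 (corner G)); rewrite /= /turn (cornerK wfG).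
    by apply/eqP; rewrite flip_end_free.
  by rewrite flip_end_flags corner_flags.
apply/eqP; rewrite iterSr /=.
have f'G : flip_end (corner G f) \in flags G.
  by rewrite flip_end_flags corner_flags.
move=> /(congr1 (fun f => flip_end (corner G f))).
rewrite {1}/turn (cornerK wfG) ?flip_endK ?flip_end_flags; last first.
  by apply: iter_turn_flags; apply: turn_flags; apply: corner_flags.
by apply/eqP; apply: IHn.
Qed.

Lemma exit_iter g : g \in flags G -> exists n, exit g = iter n turn g.
Proof.
move: g; apply: exit_ind => g gG gC; first by exists 0%N; rewrite exit_out.
by case=> n eq_n; exists n.+1; rewrite iterSr (exit_turn gG gC).
Qed.

Lemma well_formed_contract : well_formed G'.
Proof.
split=> [|f|f|f]; first by rewrite setSD //; case: wfG.
- rewrite mem_flags_contract => /andP[_ fG].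
  by rewrite contract_cornerE // exit_flags // corner_flags.
- rewrite mem_flags_contract => /andP[fC fG].
  rewrite (contract_cornerE fG) contract_corner_exit ?corner_flags //.
  by rewrite (cornerK wfG) // exit_out.
rewrite mem_flags_contract => /andP[fC fG].
rewrite contract_cornerE //.
by have [n ->] := exit_iter (corner_flags wfG fG); apply: iter_turn_corner.
Qed.

Lemma invariant_exit P Q w g : C \subset P -> invariant G P Q w ->
  g \in flags G -> w (exit g) = w g.
Proof.
move=> /subsetP CP [cw Pw _ _]; move: g; apply: exit_ind => g gG gC.
  by rewrite exit_out.
by rewrite -(exit_turn gG gC) => ->;
  rewrite /turn cw ?flip_end_flags // Pw // CP.
Qed.

(** Restriction to the surviving flags is an isomorphism of spaces of invariants: a function
    invariant along [C] is determined by its values at exits, and composition with [exit] is the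
    inverse. *)
Lemma orbits_contract P Q : Q \subset S :\: C ->
  orbits G' P Q = orbits G (C :|: P) Q.
Proof.
move=> QC.
rewrite -(rank_invariant_mx well_formed_contract) -(rank_invariant_mx wfG).
set Y := invariant_mx G' P Q; set X := invariant_mx G (C :|: P) Q.
pose D : 'M['F_2]_#|flag E| :=
  \matrix_(k, l) ((k == l) && (enum_val k \in flags G'))%:R.
have coefD u f : coef (u *m D) f = coef u f * (f \in flags G')%:R.
  rewrite coefM (bigD1 (enum_rank f)) //= mxE enum_rankK eqxx big1 ?addr0 //.
  by move=> k /negPf ne; rewrite mxE ne mulr0.
have XD0 : (X :&: kermx D)%MS = 0.
  apply/eqP; rewrite -submx0; apply/rV_subP => v.
  rewrite sub_capmx => /andP[/(invariant_mxP wfG) vi /sub_kermxP v0].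
  suff -> : v = 0 by rewrite sub0mx.
  apply: coefP => g; rewrite [RHS]mxE; have [gG|gG] := boolP (g \in flags G).
    rewrite -(invariant_exit _ vi) ?subsetUl //.
    have := coefD v (exit g); rewrite v0 exit_flags // mulr1 => <-.
    by rewrite /coef mxE.
  by case: vi => _ _ _ ->.
have := mxrank_mul_ker X D; rewrite XD0 mxrank0 addn0 => <-.
apply: eqmx_rank; apply/andP; split; apply/rV_subP => v.
  move=> /(invariant_mxP well_formed_contract)[cv Pv Qv v0].
  pose w g := if g \in flags G then coef v (exit g) else 0.
  have -> : v = vec w *m D.
    apply: coefP => f; rewrite coefD coef_vec /w mem_flags_contract.
    have [fG|fG] := boolP (f \in flags G).
      rewrite andbT; have [fC|fC] := boolP (edge_of f \in C).
        by rewrite mulr0 v0 // mem_flags_contract fC.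
      by rewrite mulr1 exit_out.
    by rewrite mul0r v0 // mem_flags_contract (negPf fG) andbF.
  apply: submxMr; apply/(invariant_mxP wfG).
  apply: (@eq_invariant _ _ _ _ w) => [f|]; first by rewrite coef_vec.
  have cw g : g \in flags G -> w (corner G g) = w g.
    move=> gG; rewrite /w corner_flags // gG -contract_corner_exit // cv //.
    exact: exit_flags.
  split=> // f fG => [|fQ|]; last 1 first.
  - by rewrite /w (negPf fG).
  - have [fC _|fC] := boolP (edge_of f \in C).
      rewrite -cw ?flip_end_flags // /w corner_flags ?flip_end_flags // fG.
      by rewrite (exit_turn fG fC).
    rewrite inE (negPf fC) /= => fP.
    rewrite /w flip_end_flags fG !exit_out // Pv // mem_flags_contract fG.
    by rewrite fC.
  have /setDP[_ fC] := subsetP QC _ fQ.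
  by rewrite /w flip_side_flags fG !exit_out // Qv // mem_flags_contract fG fC.
move=> /submxP[u ->]; rewrite mulmxA.
have /(invariant_mxP wfG) : (u *m X <= X)%MS by apply: submxMl.
move: (u *m X) => {}v vi; have [cv Pv Qv v0] := vi.
apply/(invariant_mxP well_formed_contract); split=> f.
- move=> fG'; rewrite !coefD (corner_flags well_formed_contract fG') fG' !mulr1.
  move: fG'; rewrite mem_flags_contract => /andP[fC fG].
  rewrite contract_cornerE // (invariant_exit _ vi) ?subsetUl ?corner_flags //.
  by rewrite cv.
- rewrite !coefD !mem_flags_contract flip_end_flags => /andP[fC fG] fP.
  by rewrite Pv // inE fP orbT.
- rewrite !coefD !mem_flags_contract flip_side_flags => /andP[fC fG] fQ.
  by rewrite Qv.
by rewrite coefD => /negPf->; rewrite mulr0.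
Qed.

Lemma nb_vertices_contract : nb_vertices G' = b0 G C.
Proof.
apply: etrans (orbits_contract set0 (subxx _)) _; rewrite setU0.
exact: orbits_forest (subxx C) (subxx _) (subsetDl _ _).
Qed.

Lemma forestU : C :|: (S :\: C) = S.
Proof. by rewrite -{1}(setIidPr CS) setID. Qed.

Lemma nb_faces_contract : nb_faces G' = nb_faces G.
Proof.
apply: etrans (orbits_contract (S :\: C) (sub0set _)) _.
rewrite forestU; reflexivity.
Qed.

Lemma b0_contract H : b0 G' H = b0 G (C :|: H).
Proof.
rewrite /b0 (orbits_contract H (subxx _)).
exact: orbits_forest (subsetUl _ _) (subxx _) (subsetDl _ _).
Qed.

Lemma b0_compl_contract H : b0_compl G' H = b0_compl G (C :|: H).
Proof.
apply: etrans (orbits_contract (S :\: C) (subsetDl _ H)) _.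
rewrite setDDl forestU; reflexivity.
Qed.

Lemma in_RP2_contract : in_RP2 G'.
Proof.
have cardC := cardsID C S; rewrite (setIidPr CS) in cardC.
have chi := euler_RP2 planeG; have conn := b0_skel planeG.
split; first exact: well_formed_contract.
- apply: etrans (orbits_contract (S :\: C) (subxx _)) _.
  rewrite forestU; apply: etrans _ conn.
  exact: orbits_forest CS (subxx _) (subsetDl _ _).
rewrite /euler_surface nb_vertices_contract nb_faces_contract.
have -> : skel G' = S :\: C by [].
move: forestC cardC chi; lia.
Qed.

(** Contraction lowers the numbers of vertices and of edges alike by [#|C|] and keeps both component
    counts. *)
Lemma essential_contract H : H \subset S :\: C ->
  essential G' H = essential G (C :|: H).
Proof.
rewrite subsetD => /andP[_ HC].
rewrite /essential b0_contract b0_compl_contract nb_vertices_contract.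
rewrite cardsU setIC (disjoint_setI0 HC) cards0 subn0.
by rewrite -forestC; apply/idP/idP; lia.
Qed.

End Contraction.

(** * The myopic recursion *)

Lemma big_subset_split (R : nmodType) (E : finType) (A : {set E}) (e : E)
    (p : pred {set E}) (F : {set E} -> R) : e \in A ->
  \sum_(H : {set E} | (H \subset A) && p H) F H =
  \sum_(H : {set E} | (H \subset A :\ e) && p H) F H +
  \sum_(H : {set E} | (H \subset A :\ e) && p (e |: H)) F (e |: H).
Proof.
move=> eA; rewrite (bigID (fun H : {set E} => e \notin H)) /=; congr (_ + _).
  by apply: eq_bigl => H; rewrite subsetD1 andbAC.
rewrite (reindex_onto (fun H => e |: H) (fun H => H :\ e)) /=; last first.
  by move=> H /andP[_]; rewrite negbK; apply: setD1K.
apply: eq_bigl => H; rewrite subsetD1 subUset sub1set eA setU11 /= andbT.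
have -> : ((e |: H) :\ e == H) = (e \notin H).
  by apply/eqP/idP => [<-|/setU1K//]; rewrite setD11.
by rewrite andbAC.
Qed.

Section MyopicPolynomial.
Variable E : finType.
Implicit Types (G : embgraph E) (e : E) (H K P Q : {set E}).

(** The exponent of [y2 - 1] is the dimension of the kernel of [i_*], by [dim_ker_inclE]. *)
Definition tutte_term G H : {mpoly int[2]} :=
  (x2 - 1) ^+ (b0 G H - b0 G (edges G)) * (y2 - 1) ^+ (b0_compl G H).-1.

Definition myopic_sum G : {mpoly int[2]} :=
  \sum_(H : {set E} | (H \subset edges G) && ~~ essential G H) tutte_term G H.

Lemma in_RP2_delete G e : in_RP2 G -> in_RP2 (delete G e).
Proof.
case=> [[sub cG cK cF] conn chi]; split; [|exact conn|exact chi].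
split; [|exact cG|exact cK|exact cF].
exact: subset_trans (subD1set _ _) sub.
Qed.

Section Surface.
Variable G : embgraph E.
Hypothesis planeG : in_RP2 G.
Local Notation S := (skel G).

Let wfG : well_formed G. Proof. by case: planeG. Qed.

Lemma edges_skel : edges G \subset S.
Proof. by case: wfG. Qed.

Lemma connect_adjS P Q P' Q' f g : P \subset P' -> Q \subset Q' ->
  f \in flags G -> connect (adj G P Q) f g -> connect (adj G P' Q') f g.
Proof.
move=> sP sQ fG /(connect_invariantP wfG _ _ _ fG) eq_w.
apply/(connect_invariantP wfG _ _ _ fG) => w wi; apply: eq_w.
exact: invariant_sub wi.
Qed.

Lemma b0_compl_gt0 H : H \subset S -> (0 < b0_compl G H)%N.
Proof. by move=> HS; rewrite -(dim_ker_inclE planeG HS). Qed.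

Lemma b0_mono H K : H \subset K -> (b0 G K <= b0 G H)%N.
Proof. by move=> HK; apply: orbits_mono. Qed.

Lemma eq_essential H K :
  (#|H| + b0 G H + b0_compl G K = #|K| + b0 G K + b0_compl G H)%N ->
  essential G H = essential G K.
Proof. by rewrite /essential => eq_HK; apply/idP/idP; lia. Qed.

Lemma card_b0_set1 e : e \in S ->
  (#|[set e]| + b0 G [set e] = nb_vertices G + is_loop G e)%N.
Proof.
move=> eS; have := b0_add wfG set0 eS.
rewrite setU0 cards1 -[b0 G set0]/(nb_vertices G) => ->.
rewrite -[is_loop G e]/
  (connect (adj G set0 S) (e, false, false) (e, true, false)).
by case: connect => /=; lia.
Qed.

Lemma tutte_term_delete e H : b0 G (edges G :\ e) = b0 G (edges G) ->
  tutte_term (delete G e) H = tutte_term G H.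
Proof. by move=> eq_b; rewrite /tutte_term -eq_b; reflexivity. Qed.

Lemma myopic_sum_delete e : b0 G (edges G :\ e) = b0 G (edges G) ->
  \sum_(H : {set E} | (H \subset edges G :\ e) && ~~ essential G H)
     tutte_term G H = myopic_sum (delete G e).
Proof.
move=> eq_b; apply: eq_bigr => H _; exact: esym (tutte_term_delete H eq_b).
Qed.

Section Edge.
Variable e : E.
Hypothesis eG : e \in edges G.

Let eS : e \in S. Proof. exact: subsetP edges_skel e eG. Qed.

Lemma subset_delete H : H \subset edges G :\ e ->
  [/\ e \notin H, H \subset S, e |: H \subset S & e |: H \subset edges G].
Proof.
rewrite subsetD1 => /andP[HG eH]; have HS := subset_trans HG edges_skel.
by split=> //; rewrite subUset sub1set ?eS ?eG.
Qed.

Lemma myopic_sum_contract : ~~ is_loop G e ->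
  \sum_(H : {set E} | (H \subset edges G :\ e) && ~~ essential G (e |: H))
     tutte_term G (e |: H) = myopic_sum (contract G e).
Proof.
move=> loop; have e1S : [set e] \subset S by rewrite sub1set.
have forest : (#|[set e]| + b0 G [set e] = nb_vertices G)%N.
  by rewrite card_b0_set1 // (negPf loop) addn0.
apply: eq_big => [H|H /andP[HG _]].
  apply: andb_id2l => HG; have [eH HS _ _] := subset_delete HG.
  congr (~~ _); apply: esym; apply: essential_contract => //.
  by rewrite subsetD1 HS.
rewrite /tutte_term (b0_contract planeG e1S forest).
rewrite (b0_contract planeG e1S forest) (b0_compl_contract planeG e1S forest).
rewrite (_ : [set e] :|: edges (contract G e) = edges G) //.
exact: setD1K.
Qed.

Lemma loop_b0 H : is_loop G e -> b0 G H = b0 G (e |: H).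
Proof.
move=> loop; have fG : (e, false, false) \in flags G by rewrite mem_flags.
have conn := connect_adjS (sub0set H) (subxx S) fG loop.
by apply: etrans (b0_add wfG H eS) _; rewrite conn addn0.
Qed.

Lemma loop_b0_edges : is_loop G e -> b0 G (edges G :\ e) = b0 G (edges G).
Proof. by move=> loop; rewrite (loop_b0 _ loop) setD1K. Qed.

(** Adding [e] cuts a component of the complement in two and changes neither [b0] nor [essential],
    so each pair [H], [e |: H] contributes 1 + (y - 1) times the term of [H]. *)
Lemma myopic_sum_null_loop : is_loop G e -> null_homologous G e ->
  myopic_sum G = y2 * myopic_sum (delete G e).
Proof.
move=> loop; rewrite (null_homologousE planeG eS) => sep.
have compl H : H \subset edges G :\ e ->
    b0_compl G (e |: H) = (b0_compl G H).+1.
  case/subset_delete=> eH HS _ _; rewrite (b0_compl_add wfG eS eH).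
  case: (boolP (connect _ _ _)) => [conn|_]; last by rewrite addn1.
  case/negP: sep; apply: connect_adjS conn; rewrite ?mem_flags //.
  by rewrite setDS // subsetUl.
have ess H : H \subset edges G :\ e -> essential G (e |: H) = essential G H.
  move=> HG; have [eH HS eHS _] := subset_delete HG.
  apply: eq_essential; rewrite -(loop_b0 H loop) (compl H HG) cardsU1 eH /=.
  lia.
rewrite {1}/myopic_sum (big_subset_split _ _ eG).
rewrite [X in _ + X](_ : _ = \sum_(H : {set E} |
    (H \subset edges G :\ e) && ~~ essential G H) (y2 - 1) * tutte_term G H).
  rewrite -mulr_sumr -[X in X + _]mul1r -mulrDl addrC subrK.
  by rewrite (myopic_sum_delete (loop_b0_edges loop)).
apply: eq_big => [H|H /andP[HG _]].
  by apply: andb_id2l => HG; rewrite ess.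
have [_ HS _ _] := subset_delete HG.
rewrite /tutte_term -(loop_b0 H loop) (compl H HG) /=.
by rewrite -{1}(prednK (b0_compl_gt0 HS)) exprS mulrCA.
Qed.

Lemma myopic_sum_essential_loop : is_loop G e -> ~~ null_homologous G e ->
  myopic_sum G = myopic_sum (delete G e).
Proof.
move=> loop; rewrite (null_homologousE planeG eS) negbK => conn.
have e1S : [set e] \subset S by rewrite sub1set.
(* The loop does not separate, so its complement is connected, and the cycle rank 1 exceeds the
   dimension 0 of the kernel. *)
have ess1 : essential G [set e].
  have := essentialE planeG e1S; rewrite (card_b0_set1 eS) loop.
  have := b0_compl_add wfG eS (negbT (in_set0 e)); rewrite setU0 conn.
  rewrite (b0_compl0 planeG) => ->.
  by case: essential => /=; lia.
rewrite {1}/myopic_sum (big_subset_split _ _ eG) [X in _ + X]big_pred0.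
  by rewrite addr0 (myopic_sum_delete (loop_b0_edges loop)).
move=> H; apply/negP => /andP[HG /negP[]].
have [_ _ eHS _] := subset_delete HG.
exact: (essential_sub planeG (subsetUl _ _) eHS ess1).
Qed.

Lemma bridge_not_loop : is_bridge G e -> ~~ is_loop G e.
Proof.
by apply: contraL => loop; rewrite /is_bridge (loop_b0_edges loop) ltnn.
Qed.

Lemma myopic_sum_ordinary : ~~ is_bridge G e -> ~~ is_loop G e ->
  myopic_sum G = myopic_sum (delete G e) + myopic_sum (contract G e).
Proof.
rewrite /is_bridge -leqNgt => le_b loop.
have eq_b : b0 G (edges G :\ e) = b0 G (edges G).
  apply: anti_leq; apply/andP; split; first exact: le_b.
  exact: b0_mono (subD1set _ _).
apply: etrans (big_subset_split _ _ eG) _.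
exact: f_equal2 (myopic_sum_delete eq_b) (myopic_sum_contract loop).
Qed.

(** Omitting [e] raises [b0] by 1 and changes neither [b0_compl] nor [essential], so each pair
    contributes (x - 1) + 1 times the term of [e |: H]. *)
Lemma myopic_sum_bridge : is_bridge G e ->
  myopic_sum G = x2 * myopic_sum (contract G e).
Proof.
move=> bridge; have loop := bridge_not_loop bridge.
have fG : (e, false, false) \in flags G by rewrite mem_flags.
have nconn H : H \subset edges G :\ e ->
    ~~ connect (adj G H S) (e, false, false) (e, true, false).
  move=> HG; apply: contraL bridge => conn.
  rewrite /is_bridge (b0_add wfG (edges G :\ e) eS) (setD1K eG).
  by rewrite (connect_adjS HG (subxx S) fG conn) addn0 ltnn.
have b0H H : H \subset edges G :\ e -> b0 G H = (b0 G (e |: H)).+1.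
  by move=> HG; rewrite (b0_add wfG H eS) nconn // addn1.
have compl H : H \subset edges G :\ e -> b0_compl G (e |: H) = b0_compl G H.
  move=> HG; have [eH HS _ _] := subset_delete HG.
  rewrite (b0_compl_add wfG eS eH).
  by rewrite (bridge_not_separating wfG eS (nconn H HG) HS) addn0.
have ess H : H \subset edges G :\ e -> essential G (e |: H) = essential G H.
  move=> HG; have [eH HS eHS _] := subset_delete HG.
  apply: eq_essential; rewrite (b0H H HG) (compl H HG) cardsU1 eH /=.
  lia.
have -> : x2 * myopic_sum (contract G e) =
    (x2 - 1) * myopic_sum (contract G e) + myopic_sum (contract G e).
  by rewrite mulrBl mul1r subrK.
apply: etrans (big_subset_split _ _ eG) _.
apply: f_equal2; last exact: myopic_sum_contract loop.
rewrite -(myopic_sum_contract loop) mulr_sumr.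
apply: eq_big => [H|H /andP[HG _]].
  by apply: andb_id2l => HG; rewrite ess.
have [_ _ _ eHG] := subset_delete HG.
by rewrite /tutte_term (compl H HG) (b0H H HG) subSn ?b0_mono // exprS mulrA.
Qed.

End Edge.

Lemma myopic_sum0 : edges G = set0 -> myopic_sum G = 1.
Proof.
move=> G0; rewrite /myopic_sum (big_pred1 set0) => [|H].
  by rewrite /tutte_term G0 subnn (b0_compl0 planeG) !expr0 mul1r.
rewrite G0 subset0 /=; case: eqP => //= ->.
rewrite /essential cards0 add0n -[b0 G set0]/(nb_vertices G).
by rewrite (b0_compl0 planeG) ltnn.
Qed.

End Surface.

Lemma in_RP2_contract_edge G e : in_RP2 G -> e \in edges G ->
  ~~ is_loop G e -> in_RP2 (contract G e).
Proof.
move=> planeG eG loop; have eS := subsetP (edges_skel planeG) e eG.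
apply: in_RP2_contract => //; first by rewrite sub1set.
by rewrite card_b0_set1 // (negPf loop) addn0.
Qed.

Lemma myopic_rec_unique G p : in_RP2 G -> myopic_rec G p -> p = myopic_sum G.
Proof.
move=> + rec; elim: rec => {G p}.
- by move=> G G0 planeG; rewrite myopic_sum0.
- move=> G e p q eG bridge loop _ IHp _ IHq planeG.
  rewrite (myopic_sum_ordinary planeG eG bridge loop).
  rewrite (IHp (in_RP2_delete e planeG)).
  by rewrite (IHq (in_RP2_contract_edge planeG eG loop)).
- move=> G e p eG bridge _ IHp planeG.
  have loop := bridge_not_loop planeG eG bridge.
  rewrite (myopic_sum_bridge planeG eG bridge).
  by rewrite (IHp (in_RP2_contract_edge planeG eG loop)).
- move=> G e p eG loop null _ IHp planeG.
  rewrite (myopic_sum_null_loop planeG eG loop null).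
  by rewrite (IHp (in_RP2_delete e planeG)).
move=> G e p eG loop null _ IHp planeG.
rewrite (myopic_sum_essential_loop planeG eG loop null).
exact: IHp (in_RP2_delete e planeG).
Qed.

(** Deletion and contraction both remove [e], so any choice of edges terminates. *)
Lemma myopic_rec_sum G : in_RP2 G -> myopic_rec G (myopic_sum G).
Proof.
have [n] := ubnP #|edges G|; elim: n G => // n IHn G leG planeG.
have [G0|[e eG]] := set_0Vmem (edges G).
  by rewrite (myopic_sum0 planeG G0); apply: MyopicEmpty.
have lt_e : (#|edges G :\ e| < n)%N by have := cardsD1 e (edges G);
  rewrite eG; lia.
have del : myopic_rec (delete G e) (myopic_sum (delete G e)).
  exact: (IHn (delete G e) lt_e (in_RP2_delete e planeG)).
have con : ~~ is_loop G e ->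
    myopic_rec (contract G e) (myopic_sum (contract G e)).
  move=> loop; apply: (IHn (contract G e) lt_e).
  exact: (in_RP2_contract_edge planeG eG loop).
have [loop|loop] := boolP (is_loop G e).
  have [null|null] := boolP (null_homologous G e).
    rewrite (myopic_sum_null_loop planeG eG loop null).
    exact: MyopicNullLoop eG loop null del.
  rewrite (myopic_sum_essential_loop planeG eG loop null).
  exact: MyopicEssentialLoop eG loop null del.
have [bridge|bridge] := boolP (is_bridge G e).
  rewrite (myopic_sum_bridge planeG eG bridge).
  exact: MyopicBridge eG bridge (con loop).
rewrite (myopic_sum_ordinary planeG eG bridge loop).
exact: MyopicOrdinary eG bridge loop del (con loop).
Qed.

Lemma is_myopic_tutte_sum G : in_RP2 G -> is_myopic_tutte G (myopic_sum G).
Proof.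
move=> planeG p; split=> [|->]; first exact: myopic_rec_unique.
exact: myopic_rec_sum.
Qed.

End MyopicPolynomial.

(** * Inessential graphs are local *)

Lemma n_comp_split (T : finType) (r r' : rel T) (A B : {set T}) :
  B \subset A -> {in A :\: B, forall x, connect r x =1 connect r' x} ->
  n_comp r A = (n_comp r B + n_comp r' (A :\: B))%N.
Proof.
move=> /subsetP BA eq_r; rewrite /n_comp_mem -(cardID (mem B)); congr (_ + _)%N.
  apply: eq_card => x; rewrite !inE /= -andbA; congr (_ && _).
  by apply/andP/idP => [[]|xB] //; rewrite BA.
apply: eq_card => x; rewrite !inE /=.
case xB: (x \in B); case xA: (x \in A); rewrite ?andbF //= ?andbT.
by rewrite /fingraph.roots /fingraph.root (eq_pick (eq_r x _)) // inE xB.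
Qed.


Section InessentialGraph.
Variables (E : finType) (G : embgraph E).
Hypotheses (planeG : in_RP2 G) (connG : connected_graph G).
Hypothesis inessG : ~~ essential G (edges G).
Implicit Types (H K P Q : {set E}) (f g : flag E) (w : flag E -> 'F_2).
Local Notation S := (skel G).

Let wfG : well_formed G. Proof. by case: planeG. Qed.

Lemma b0_spanning H : edges G \subset H -> H \subset S -> b0 G H = 1%N.
Proof.
move=> GH HS; have le := b0_mono planeG GH; have ge := b0_mono planeG HS.
rewrite connG in le; rewrite (b0_skel planeG) in ge.
by apply: anti_leq; rewrite le ge.
Qed.

Lemma essential_skel : essential G S.
Proof.
rewrite /essential /b0_compl setDv (b0_skel planeG).
rewrite -[orbits G S set0]/(nb_faces G).
by rewrite (euler_RP2 planeG); lia.
Qed.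

(** Here [b0] stays 1, so in [essentialE] the new edge is paid for either by a new component of the
    complement or by becoming essential. *)
Lemma essential_step H e : edges G \subset H -> H \subset S ->
  e \in S -> e \notin H ->
  (essential G (e |: H) +
     ~~ connect (adj G S (S :\: (e |: H))) (e, false, false) (e, false, true) =
   (essential G H).+1)%N.
Proof.
move=> GH HS eS eH.
have eHS : e |: H \subset S by rewrite subUset sub1set eS.
have := essentialE planeG HS; have := essentialE planeG eHS.
have GeH : edges G \subset e |: H := subset_trans GH (subsetUr _ _).
rewrite (b0_spanning GH HS) (b0_spanning GeH eHS).
rewrite (b0_compl_add wfG eS eH) cardsU1 eH /=.
move: (b0_compl _ _) (nb_vertices _) #|_| => b v h.
by case: connect; case: essential; case: essential => /=; lia.
Qed.

(** Take a maximal inessential [K] containing the graph. It is not the whole skeleton, so some edge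
    makes it essential, and by [essential_step] that edge does not separate. *)
Lemma unseparating_edge : exists e,
  [/\ e \in S, e \notin edges G &
      connect (adj G S (S :\: (e |: edges G)))
        (e, false, false) (e, false, true)].
Proof.
pose p K := [&& edges G \subset K, K \subset S & ~~ essential G K].
have pG : p (edges G) by rewrite /p subxx edges_skel.
have [K /maxsetP[/and3P[GK KS essK] maxK] _] := maxset_exists pG.
have /properP[_ [e eS eK]] : K \proper S.
  rewrite properEneq KS andbT; apply: contraNneq essK => ->.
  exact: essential_skel.
have eKS : e |: K \subset S by rewrite subUset sub1set eS.
have essK' : essential G (e |: K).
  apply: contraR eK => ness.
  have pK' : p (e |: K) by rewrite /p eKS ness (subset_trans GK (subsetUr _ _)).
  by rewrite -(maxK _ pK' (subsetUr _ _)) setU11.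
have eG : e \notin edges G by apply: contra eK; apply: (subsetP GK).
have fG : (e, false, false) \in flags G by rewrite mem_flags.
have := essential_step GK KS eS eK; rewrite essK' (negPf essK).
case conn : connect => //= _; exists e; split=> //.
exact: connect_adjS (subxx S) (setDS _ (setUS _ GK)) fG conn.
Qed.

Section UnseparatingEdge.
Variable e0 : E.
Hypotheses (e0S : e0 \in S) (e0G : e0 \notin edges G).
Local Notation C := (S :\: edges G).
Local Notation f0 := (e0, false, false).
Hypothesis e0conn :
  connect (adj G S (S :\: (e0 |: edges G))) f0 (e0, false, true).

(** [D] is the component of the complement of the graph containing [e0]. Removing it leaves the
    subcomplex with edges [H] and faces in [W], whose neighbourhood is the required disk. *)
Let D : {set flag E} := [set f | connect (adj G S C) f0 f].
Let CD : {set E} := [set e in C | (e, false, false) \in D].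
Let H := S :\: CD.
Let W := flags G :\: D.

Let f0G : f0 \in flags G. Proof. by rewrite mem_flags. Qed.

Let f0D : f0 \in D. Proof. by rewrite inE connect0. Qed.

Lemma component_invariant : invariant G S C (fun f => (f \in D)%:R).
Proof.
by apply: eq_invariant (invariant_component wfG S C f0G) => f; rewrite inE.
Qed.

Lemma component_corner f : f \in flags G -> (corner G f \in D) = (f \in D).
Proof. by case: component_invariant => cD _ _ _ /cD/natr_bool_F2_inj. Qed.

Lemma component_flip_end f : f \in flags G -> (flip_end f \in D) = (f \in D).
Proof.
case: component_invariant => _ SD _ _ fG.
by apply: natr_bool_F2_inj; apply: SD; rewrite // inE in fG.
Qed.

Lemma component_flip_side f : f \in flags G -> edge_of f \in C ->
  (flip_side f \in D) = (f \in D).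
Proof.
case: component_invariant => _ _ CDi _ fG fC.
by apply: natr_bool_F2_inj; apply: CDi.
Qed.

Lemma component_flags f : f \in D -> f \in flags G.
Proof.
rewrite inE => /(closed_connect (@adj_closed _ G S C)).
by rewrite f0G => <-.
Qed.

Lemma component_edge f : f \in flags G -> edge_of f \in C ->
  (f \in D) = (edge_of f \in CD).
Proof.
move=> fG fC; rewrite [RHS]inE fC /=.
case: f fG fC => [[e i] s] fG fC.
have eS : e \in S by rewrite inE in fG.
have side j t : ((e, j, t) \in D) = ((e, j, false) \in D).
  by case: t => //; rewrite -(@component_flip_side (e, j, false)) ?mem_flags.
rewrite side; case: i fG fC => // fG fC.
by rewrite -(@component_flip_end (e, false, false)) ?mem_flags.
Qed.

Lemma CD_sub : CD \subset C.
Proof. by apply/subsetP => e; rewrite inE => /andP[]. Qed.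

Lemma invariant_component_restrict P Q w :
  CD :&: Q \subset P -> P \subset CD -> Q \subset C ->
  invariant G S P w ->
  invariant G S Q (fun f => if f \in D then w f else 0).
Proof.
move=> /subsetP QP PC /subsetP QC [cw Sw Pw w0]; split=> f fG.
- by rewrite component_corner // cw.
- by move=> fS; rewrite component_flip_end // Sw.
- move=> fQ; rewrite component_flip_side ?QC //; case: ifP => // fD.
  by apply: Pw => //; apply: QP; rewrite inE fQ -component_edge ?QC ?fD.
by case: ifP => // /component_flags; rewrite (negPf fG).
Qed.

(** Edges outside [CD] do not help to connect flags of [D], since invariant functions on [D] extend
    by 0. *)
Lemma connect_component Q f : Q \subset C -> f \in D ->
  connect (adj G S Q) f0 f -> connect (adj G S (CD :&: Q)) f0 f.
Proof.
move=> QC fD /(connect_invariantP wfG _ _ _ f0G) eq_w.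
apply/(connect_invariantP wfG _ _ _ f0G) => w wi.
have := eq_w _ (invariant_component_restrict (subxx _) (subsetIl _ _) QC wi).
by rewrite f0D fD.
Qed.

Lemma edges_subH : edges G \subset H.
Proof.
apply/subsetP => e eG; rewrite inE (subsetP (edges_skel planeG) e eG) andbT.
by apply: contraL eG => /(subsetP CD_sub); rewrite inE => /andP[].
Qed.

Lemma skelDH : S :\: H = CD.
Proof.
by rewrite setDDr setDv set0U; apply/setIidPr/(subset_trans CD_sub)/subsetDl.
Qed.

Lemma e0CD : e0 \in CD.
Proof. by rewrite -[e0]/(edge_of f0) -component_edge // inE e0G. Qed.

Lemma e0_sideD : (e0, false, true) \in D.
Proof.
by rewrite (@component_flip_side f0) // inE e0G.
Qed.

(** The path joining the two sides of [e0] stays in [D], so [e0] does not separate the complement of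
    [H]; [essential_step] then forces adding [e0] to create essentiality. *)
Lemma inessentialH : ~~ essential G H.
Proof.
have e0H : e0 \notin H by rewrite inE e0CD.
have := essential_step edges_subH (subsetDl S CD) e0S e0H.
have -> : S :\: (e0 |: H) = CD :&: (S :\: (e0 |: edges G)).
  have notG e : e \in CD -> e \notin edges G by rewrite !inE => /andP[/andP[]].
  apply/setP => e; rewrite setDUr skelDH !in_setI.
  rewrite !in_setD in_set1 in_setU1 negb_or.
  by case: (boolP (e \in CD)) => [/notG->|]; rewrite ?andbF ?andbT.
have sub := setDS S (subsetUr [set e0] (edges G)).
rewrite (connect_component sub e0_sideD e0conn) /= addn0.
by case: essential; case: essential.
Qed.

Lemma n_comp_component : n_comp (adj G S CD) D = 1%N.
Proof.
rewrite -(n_comp_connect (adj_connect_sym wfG S CD) f0).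
apply: eq_n_comp_r => f; rewrite [RHS]inE; apply/idP/idP => [fD|].
  have -> : CD = CD :&: C by apply/esym/setIidPl/CD_sub.
  by apply: connect_component => //; rewrite inE in fD.
rewrite [f \in D]inE; apply: connect_adjS => //; exact: CD_sub.
Qed.

Lemma connect_outside f g : f \in W ->
  connect (adj G S CD) f g = connect (face_adj G) f g.
Proof.
move=> /setDP[fG fD]; apply/idP/idP; last first.
  by apply: connect_adjS => //; apply: sub0set.
move=> /(connect_invariantP wfG _ _ _ fG) eq_w.
apply/(connect_invariantP wfG _ _ _ fG) => w wi.
have [cw Sw _ w0] := wi.
have gD : g \notin D.
  apply: contra fD => gD; suff <- : (g \in D) = (f \in D) by [].
  apply/esym/natr_bool_F2_inj/(eq_w (fun f => (f \in D)%:R)).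
  exact: invariant_sub (subxx S) CD_sub component_invariant.
have := eq_w (fun f => if f \in D then 0 else w f).
rewrite (negPf fD) (negPf gD); apply; split=> h hG.
- by rewrite component_corner // cw.
- by move=> hS; rewrite component_flip_end // Sw.
- move=> hC; have hC' := subsetP CD_sub _ hC.
  by rewrite component_flip_side // component_edge // hC.
by rewrite w0 // if_same.
Qed.

(** The complement of [H] consists of [D], which is connected, and of the separate faces outside
    it. *)
Lemma n_comp_outside : b0_compl G H = (n_comp (face_adj G) W).+1.
Proof.
rewrite /b0_compl skelDH /orbits -[RHS]add1n -n_comp_component.
apply: n_comp_split; last by move=> f fW g; apply: connect_outside.
by apply/subsetP => f; apply: component_flags.
Qed.

Lemma local_unseparating : local_graph G.
Proof.
exists H, W; split.
- by rewrite edges_subH subsetDl.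
- split.
  + apply/properP; split; first exact: subsetDl.
    by exists f0; rewrite // inE f0D.
  + move=> f g /and3P[fG gG]; rewrite !in_setD fG gG !andbT.
    move=> /or3P[/eqP->|/andP[_ /eqP->]|/andP[]]; last by rewrite inE.
      by rewrite component_corner.
    by rewrite component_flip_end.
  move=> f /setDP[fG fD]; rewrite inE; apply/andP; split.
    by apply: contra fD => fCD; rewrite component_edge ?(subsetP CD_sub).
  by rewrite inE in fG.
- exact: b0_spanning edges_subH (subsetDl _ _).
(* With [b0 G H = 1] and [H] inessential, this identity is the Euler characteristic 1 of the
   subcomplex. *)
have := essentialE planeG (subsetDl S CD); rewrite -/H (negPf inessentialH).
rewrite (b0_spanning edges_subH (subsetDl _ _)) n_comp_outside.
lia.
Qed.

End UnseparatingEdge.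

Lemma inessential_local : local_graph G.
Proof.
have [e [eS eG conn]] := unseparating_edge.
exact: local_unseparating eS eG conn.
Qed.

End InessentialGraph.

(** * The Krushkal polynomial *)

Section KrushkalPolynomial.
Variables (E : finType) (G : embgraph E).
Hypotheses (planeG : in_RP2 G) (connG : connected_graph G).
Implicit Types (H : {set E}).
Local Notation S := (skel G).
Local Notation D := (dual_decomposition G).
Local Notation C := (S :\: edges G).

Let wfG : well_formed G. Proof. by case: planeG. Qed.

Let planeD : in_RP2 D. Proof. exact: in_RP2_dual. Qed.

Definition krushkal_term H : {mpoly int[4]} :=
  (x4 - 1) ^+ (b0 G H - b0 G (edges G)) * (y4 - 1) ^+ (b0_compl G H).-1.

Lemma krushkalE : krushkal G =
  \sum_(H : {set E} | H \subset edges G)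
    krushkal_term H * sqrtA ^+ essential G H * sqrtB ^+ (~~ essential G H).
Proof.
apply: eq_bigr => H HG; have HS := subset_trans HG (edges_skel planeG).
by rewrite /krushkal_term (s_expE planeG HS) (s_perp_expE planeG HS)
  -(dim_ker_inclE planeG HS).
Qed.

Lemma krushkal_split : krushkal G =
  sqrtB * (\sum_(H : {set E} | (H \subset edges G) && ~~ essential G H)
             krushkal_term H) +
  sqrtA * (\sum_(H : {set E} | (H \subset edges G) && essential G H)
             krushkal_term H).
Proof.
rewrite krushkalE (bigID (fun H => ~~ essential G H)) /= !mulr_sumr.
apply: f_equal2.
  apply: eq_bigr => H /andP[_ /negPf ->].
  by rewrite expr0 expr1 mulr1 mulrC.
apply: eq_big => [H|H /andP[_]]; first by rewrite negbK.
by rewrite negbK => ->; rewrite expr0 expr1 mulr1 mulrC.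
Qed.

Lemma comp_var n k (lq : n.-tuple {mpoly int[k]}) i (lt_i_n : (i < n)%N) :
  comp_mpoly lq (var lt_i_n) = lq`_i.
Proof. exact: comp_mpolyXU. Qed.

Lemma comp_krushkal :
  comp_mpoly [tuple x2; y2; 0; 1] (krushkal G) = myopic_sum G.
Proof.
rewrite krushkal_split rmorphD !rmorphM /= !comp_var /= mul0r addr0 mul1r.
rewrite rmorph_sum; apply: eq_bigr => H _.
by rewrite /krushkal_term rmorphM !rmorphXn !rmorphB /= !comp_var !rmorph1.
Qed.

Lemma comp_myopic_sum : comp_mpoly [tuple x4; y4] (myopic_sum G) =
  \sum_(H : {set E} | (H \subset edges G) && ~~ essential G H) krushkal_term H.
Proof.
rewrite rmorph_sum; apply: eq_bigr => H _.
by rewrite /tutte_term rmorphM !rmorphXn !rmorphB /= !comp_var !rmorph1.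
Qed.

(** Adding [essentialE] for [H] and for its dual, the Euler characteristic 1 makes exactly one of
    the two essential. *)
Lemma essential_dual H : H \subset S ->
  essential D (S :\: H) = ~~ essential G H.
Proof.
move=> HS; have := essentialE planeG HS.
have := essentialE planeD (subsetDl S H).
rewrite (nb_vertices_dual wfG) (b0_dual wfG HS) (b0_compl_dual wfG HS).
have := euler_RP2 planeG; have := cardsID H S; rewrite (setIidPr HS).
move: (b0_compl _ _) (nb_vertices _) (nb_faces _) (b0 _ _) => c v f b.
by case: essential; case: essential => /=; lia.
Qed.

Hypothesis essG : essential G (edges G).

(** For a connected essential graph, [essentialE] and Euler's formula give one fewer dual edge than
    faces of the decomposition within each complementary component, in total. *)
Lemma complement_forest : (#|C| + b0 D C = nb_vertices D)%N.
Proof.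
have GS := edges_skel planeG; have := essentialE planeG GS.
rewrite (nb_vertices_dual wfG) (b0_dual wfG GS) essG connG.
have := euler_RP2 planeG; have := cardsID (edges G) S; rewrite (setIidPr GS).
move: (b0_compl _ _) (nb_vertices _) (nb_faces _) => c v f /=.
lia.
Qed.

Lemma in_RP2_poincare_dual : in_RP2 (poincare_dual G).
Proof. exact: in_RP2_contract planeD (subsetDl _ _) complement_forest. Qed.

Lemma edges_poincare_dual : edges (poincare_dual G) = edges G.
Proof.
rewrite -[LHS]/(edges G :\: C) setDDr setIid.
exact/setUidPr/subsetDl.
Qed.

(** The substitution sends [H] to [edges G :\: H], which together with the contracted edges is the
    complement of [H] in the skeleton; [b0] and [b0_compl] trade places, hence so do x and y. *)
Lemma comp_myopic_sum_dual :
  comp_mpoly [tuple y4; x4] (myopic_sum (poincare_dual G)) =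
  \sum_(H : {set E} | (H \subset edges G) && essential G H) krushkal_term H.
Proof.
have GS := edges_skel planeG.
have compl H : H \subset edges G -> C :|: (edges G :\: H) = S :\: H.
  move=> HG; apply/setP => e; have := subsetP GS e; have := subsetP HG e.
  rewrite !inE; case: (e \in H); case: (e \in edges G);
    case: (e \in S) => //= a b;
    by [have := a isT | have := b isT].
have b0P := b0_contract planeD (subsetDl S (edges G)) complement_forest.
have bcP := b0_compl_contract planeD (subsetDl S (edges G)) complement_forest.
rewrite /myopic_sum edges_poincare_dual rmorph_sum.
rewrite (reindex_onto (fun H => edges G :\: H) (fun H => edges G :\: H));
  last first.
  by move=> H /andP[HG _]; rewrite setDDr setDv set0U (setIidPr HG).
apply: eq_big => [H|H /andP[_ /eqP HG']].
  rewrite subsetDl /= setDDr setDv set0U.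
  have [HG|HG] := boolP (H \subset edges G); last first.
    by rewrite (sameP eqP setIidPr) (negPf HG) andbF.
  rewrite (setIidPr HG) eqxx andbT /=.
  rewrite (essential_contract planeD (subsetDl _ _) complement_forest);
    last first.
    rewrite setDDr subsetU // orbC subsetI !subsetDl.
    by rewrite (subset_trans (subsetDl _ _) GS).
  by rewrite (compl H HG) (essential_dual (subset_trans HG GS)) negbK.
have HG : H \subset edges G by rewrite -HG' subsetDl.
have HS := subset_trans HG GS.
have dual_edges : b0 D (C :|: edges G) = 1%N.
  have -> : C :|: edges G = S :\: set0.
    by rewrite -(compl set0 (sub0set _)) setD0.
  by rewrite (b0_dual wfG (sub0set _)) (b0_compl0 planeG).
rewrite /tutte_term edges_poincare_dual !b0P bcP dual_edges (compl H HG).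
rewrite (b0_dual wfG HS) (b0_compl_dual wfG HS).
rewrite rmorphM !rmorphXn !rmorphB /= !comp_var !rmorph1 /=.
rewrite mulrC subn1 -[(b0 G H).-1]subn1.
(* The predecessor is subtraction of 1, which is [b0 G (edges G)] by connectedness. *)
pose t m : {mpoly int[4]} :=
  (x4 - 1) ^+ (b0 G H - m) * (y4 - 1) ^+ (b0_compl G H).-1.
exact: (congr1 t (esym connG)).
Qed.

End KrushkalPolynomial.

Theorem theorem1p3 (E : finType) (G : embgraph E) :
  in_RP2 G -> connected_graph G -> ~ local_graph G ->
  exists psi psi_dual : {mpoly int[2]},
    [/\ is_myopic_tutte G psi,
        is_myopic_tutte (poincare_dual G) psi_dual,
        comp_mpoly [tuple x2; y2; 0; 1] (krushkal G) = psi
      & krushkal G = sqrtB * comp_mpoly [tuple x4; y4] psi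
                   + sqrtA * comp_mpoly [tuple y4; x4] psi_dual].
Proof.
move=> planeG connG nonlocal.
have essG : essential G (edges G).
  by apply: contra_notT nonlocal => iness; apply: inessential_local.
exists (myopic_sum G), (myopic_sum (poincare_dual G)); split.
- exact: is_myopic_tutte_sum planeG.
- exact: is_myopic_tutte_sum (in_RP2_poincare_dual planeG connG essG).
- exact: comp_krushkal planeG.
rewrite comp_myopic_sum (comp_myopic_sum_dual planeG connG essG).
exact: krushkal_split planeG.
Qed.
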